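(* Let $\mathfrak g$ be a complex simple Lie algebra of rank at least 2, $\mathfrak h$ a Cartan subalgebra with root system $\Delta$, positive roots $\Delta^+$, simple roots $\Pi$ and longest root $\eta$. Let $Z^\dagger=\Pi\cup\{-\eta\}$, $Z=\{\alpha\in\Delta\mid-\alpha\in Z^\dagger\}$, and $$\mathfrak g_Z=\bigoplus_{\alpha\in Z}\mathfrak g_\alpha,\quad \mathfrak g_{Z^\dagger}=\bigoplus_{\alpha\in Z^\dagger}\mathfrak g_\alpha,\quad \mathfrak g_1=\bigoplus_{\alpha\in\Delta\setminus(Z\cup Z^\dagger)}\mathfrak g_\alpha .$$ Then $$[\mathfrak h,\mathfrak g_{Z^\dagger}]\subset\mathfrak g_{Z^\dagger},\quad[\mathfrak h,\mathfrak g_Z]\subset\mathfrak g_Z,\quad[\mathfrak h,\mathfrak g_1]\subset\mathfrak g_1,\quad[\mathfrak g_Z,\mathfrak g_{Z^\dagger}]\subset\mathfrak h,$$ $$[\mathfrak g_{Z^\dagger},\mathfrak g_1]\subset\mathfrak g_1\oplus\mathfrak g_Z,\quad[\mathfrak g_Z,\mathfrak g_1]\subset\mathfrak g_1\oplus\mathfrak g_{Z^\dagger},$$ $$[\mathfrak g_Z,\mathfrak g_Z]\subset\mathfrak g_1\oplus\mathfrak g_{Z^\dagger},\quad[\mathfrak g_{Z^\dagger},\mathfrak g_{Z^\dagger}]\subset\mathfrak g_1\oplus\mathfrak g_Z .$$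
   Context: $\mathfrak g_\alpha$ denotes the root space of $\alpha$. The longest root $\eta$ is the unique positive root such that $\beta+\eta$ is not a root for any positive root $\beta$ (the highest root). *)

(* Defs.v *)
From HB Require Import structures.
From mathcomp Require Import all_boot all_order all_algebra.
From mathcomp Require Import finmap.
From mathcomp Require Import boolp classical_sets cardinality reals complex.

Set Implicit Arguments.
Unset Strict Implicit.
Unset Printing Implicit Defensive.

Import GRing.Theory.
Local Open Scope ring_scope.

HB.mixin Record Vector_isLieAlgebra (F : fieldType) g of Vector F g := {
  lieb : g -> g -> g;
  lieb_linearl : forall y, linear (lieb^~ y);
  lieb_linearr : forall x, linear (lieb x);
  liebb : forall x, lieb x x = 0;
  lieb_jacobi : forall x y z,
    lieb x (lieb y z) + lieb y (lieb z x) + lieb z (lieb x y) = 0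
}.

#[short(type="lieAlgType")]
HB.structure Definition LieAlgebra (F : fieldType) :=
  { g of Vector F g & Vector_isLieAlgebra F g }.

Section LieAlgebras.
Variables (F : fieldType) (g : lieAlgType F).
Implicit Types (U V W h I : {vspace g}) (x y z : g).

HB.instance Definition _ x :=
  GRing.isLinear.Build F g g *:%R (lieb x) (lieb_linearr x).

Definition ad x : 'End(g) := linfun (lieb x).

Lemma adE x y : ad x y = lieb x y.
Proof. exact: lfunE. Qed.

Lemma liebDl x y z : lieb (x + y) z = lieb x z + lieb y z.
Proof. by rewrite -[x in LHS]scale1r lieb_linearl scale1r. Qed.

Lemma lieb0l z : lieb 0 z = 0.
Proof. by apply: (addrI (lieb 0 z)); rewrite -liebDl !addr0. Qed.

Lemma liebZl c x z : lieb (c *: x) z = c *: lieb x z.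
Proof. by rewrite -[c *: x]addr0 lieb_linearl lieb0l addr0. Qed.

Lemma lieb_suml (I : Type) (r : seq I) (f : I -> g) z :
  lieb (\sum_(i <- r) f i) z = \sum_(i <- r) lieb (f i) z.
Proof. by elim/big_rec2: _ => [|i ? ? _ <-]; rewrite ?lieb0l ?liebDl. Qed.

(* [U, V] is the linear span of all brackets [u, v] (see liebvP); spanning by
   the brackets of basis vectors keeps the family finite, as in prodv. *)
Definition liebv U V : {vspace g} :=
  <<[seq lieb u v | u <- vbasis U, v <- vbasis V]>>%VS.

Lemma liebvP U V W :
  reflect (forall u v, u \in U -> v \in V -> lieb u v \in W)
          (liebv U V <= W)%VS.
Proof.
apply: (iffP idP) => [sW u v Uu Vv | sW].
  apply: (subvP sW); rewrite (coord_vbasis Uu) (coord_vbasis Vv).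
  rewrite lieb_suml; apply: memv_suml => i _.
  rewrite liebZl memvZ // linear_sum; apply: memv_suml => j _.
  rewrite linearZ memvZ // memv_span //.
  by apply: allpairs_f; apply: mem_nth; rewrite size_tuple.
apply/span_subvP => _ /allpairsP[[u v] /= [Uu Vv ->]].
by apply: sW; apply: vbasis_mem.
Qed.

Definition lie_subalgebra U : bool := (liebv U U <= U)%VS.

Definition lie_ideal I : bool := (liebv fullv I <= I)%VS.

Definition lie_simple : Prop :=
  liebv fullv fullv <> 0%VS /\
  (forall I, lie_ideal I -> I = 0%VS \/ I = fullv).

(* U = C^0 U, C^(n+1) U = [U, C^n U] is the lower central series. *)
Definition lie_nilpotent U : Prop :=
  exists n, iter n (liebv U) U = 0%VS.

Definition lie_self_normalizing U : Prop :=
  forall x, (forall u, u \in U -> lieb x u \in U) -> x \in U.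

Definition cartan_subalgebra h : Prop :=
  [/\ lie_subalgebra h, lie_nilpotent h & lie_self_normalizing h].

Definition dual h := 'Hom(subvs_of h, F^o).

Section Roots.
Variable h : {vspace g}.
Implicit Types (a b : dual h) (S Pi : {fset dual h}).

(* {x | [y, x] = a(y) x for all y in h}, see root_spaceP; it is enough to let
   y range over a basis of h. *)
Definition root_space a : {vspace g} :=
  (\bigcap_(i < \dim {:subvs_of h})
     let y := (vbasis {:subvs_of h})`_i in
     lker (ad (vsval y) - (a y : F) *: \1%VF))%VS.

Lemma root_spaceP a x :
  reflect (forall y : subvs_of h, lieb (vsval y) x = (a y : F) *: x)
          (x \in root_space a).
Proof.
rewrite /root_space memvE; apply: (iffP subv_bigcapP) => [xP y | xP i _].
  rewrite (coord_vbasis (memvf y)) !linear_sum lieb_suml scaler_suml.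
  apply: eq_bigr => i _; have := xP i isT.
  rewrite -memvE memv_ker add_lfunE opp_lfunE scale_lfunE id_lfunE adE subr_eq0 => /eqP xE.
  by rewrite !linearZ liebZl /= xE scalerA.
by rewrite -memvE memv_ker add_lfunE opp_lfunE scale_lfunE id_lfunE adE xP subrr.
Qed.

Lemma root_space_indep (s : seq (dual h)) (f : dual h -> g) : uniq s ->
  (forall a, a \in s -> f a \in root_space a) ->
  \sum_(a <- s) f a = 0 -> forall a, a \in s -> f a = 0.
Proof.
elim: s f => [|b s IHs] f //= /andP[bNs us] fs; rewrite big_cons => f0.
have fs0 a : a \in s -> f a = 0.
  move=> as_; apply/eqP/negPn/negP => fa0.
  have: a == b.
    apply/eqP/lfunP => y; apply/eqP; rewrite -subr_eq0; apply: contraNT fa0.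
    move=> aby; have: ((a y : F) - b y) *: f a == 0.
      apply/eqP; apply: (IHs (fun c => ((c y : F) - b y) *: f c)) => //.
        by move=> c cs; rewrite memvZ // fs // inE cs orbT.
      have: lieb (vsval y) (f b + \sum_(c <- s) f c) = 0 by rewrite f0 linear0.
      rewrite linearD linear_sum /= (root_spaceP _ _ (fs b (mem_head _ _))).
      have ->: f b = - \sum_(c <- s) f c by apply/eqP; rewrite -addr_eq0 f0.
      rewrite scalerN scaler_sumr addrC -sumrB => E; rewrite -[RHS]E.
      rewrite big_seq [RHS]big_seq; apply: eq_bigr => c cs.
      by rewrite scalerBl (root_spaceP _ _ (fs c _)) // inE cs orbT.
    by rewrite scaler_eq0 (negbTE aby).
  by move=> /eqP ab; rewrite -ab as_ in bNs.
move=> a; rewrite inE => /predU1P[->|/fs0 //].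
by rewrite -[LHS]addr0 -[RHS]f0 big_seq big1.
Qed.

Lemma root_space_directv (s : seq (dual h)) : uniq s ->
  directv (\sum_(a <- s) root_space a).
Proof.
move=> us; rewrite directvE /= !(big_tnth _ _ s) -directvE /=.
apply/directv_sum_independent => u uP u0 i _.
pose f a := if insub (index a s) is Some j then u j else 0.
have fE j : f (tnth (in_tuple s) j) = u j.
  rewrite /f (tnth_nth 0) /= index_uniq //; case: insubP => [k _ kj|].
    by congr u; apply: val_inj.
  by rewrite ltn_ord.
rewrite -fE; apply: (@root_space_indep s) => //; last exact: mem_tnth.
  by move=> a /(tnthP (in_tuple s))[j ->]; rewrite fE uP.
by rewrite big_tnth -[RHS]u0; apply: eq_bigr => j _; apply: fE.
Qed.

Definition is_root a : bool := (a != 0) && (root_space a != 0)%VS.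

Lemma finite_roots : finite_set [set a | is_root a]%classic.
Proof.
apply: contrapT => /(infinite_set_fset (\dim {:g}).+1)[B BP].
apply/negP; rewrite -leqNgt.
have /directvP /= dB := root_space_directv (fset_uniq B).
rewrite (leq_trans _ (dimvS (subvf (\sum_(a <- B) root_space a)%VS))) // dB.
rewrite cardfE cardE -sum1_size big_enum /= big_seq_fsetE /=.
apply: leq_sum => a _; rewrite lt0n dimv_eq0.
by have /andP[] := BP _ (valP a).
Qed.

(* Delta; fset_set is meaningful here by finite_roots. *)
Definition roots : {fset dual h} := fset_set [set a | is_root a]%classic.

Lemma in_roots a : (a \in roots) = is_root a.
Proof.
rewrite in_fset_set ?inE //; first exact/asboolP/idP.
exact: finite_roots.
Qed.

Definition nonneg_comb Pi a : Prop :=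
  exists c : dual h -> nat, a = \sum_(b <- Pi) b *+ c b.

(* Pi is a system of simple roots; a choice of Pi is a choice of Delta^+. *)
Definition simple_roots Pi : Prop :=
  [/\ {subset Pi <= roots}, free Pi
    & forall a, a \in roots -> nonneg_comb Pi a \/ nonneg_comb Pi (- a)].

Definition positive_root Pi a : Prop := a \in roots /\ nonneg_comb Pi a.

Definition longest_root Pi eta : Prop :=
  positive_root Pi eta /\
  (forall b, positive_root Pi b -> b + eta \notin roots).

(* For any finite S the sum is direct, by root_space_directv. *)
Definition root_space_sum S : {vspace g} := (\sum_(a <- S) root_space a)%VS.

Lemma root_space_sum_directv S T : [disjoint S & T]%fset ->
  directv (root_space_sum S + root_space_sum T).
Proof.
move=> dST; have uST : uniq (S ++ T).
  rewrite cat_uniq !fset_uniq andbT /=; apply/hasPn => a aT.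
  by apply: contraTN aT => aS; apply: (fdisjointP dST).
have := root_space_directv uST.
rewrite directvE /= !big_cat /= => E; rewrite directvE /=.
rewrite (eqP E); apply/eqP; congr (_ + _)%N; symmetry;
  by apply/directvP/root_space_directv/fset_uniq.
Qed.

Definition Zdag Pi eta : {fset dual h} := (Pi `|` [fset - eta])%fset.

Definition Zset Pi eta : {fset dual h} :=
  [fset a in roots | - a \in Zdag Pi eta]%fset.

Definition g_Zdag Pi eta := root_space_sum (Zdag Pi eta).

Definition g_Z Pi eta := root_space_sum (Zset Pi eta).

Definition g_1 Pi eta :=
  root_space_sum (roots `\` (Zset Pi eta `|` Zdag Pi eta))%fset.

Lemma directv_g1_gZ Pi eta : directv (g_1 Pi eta + g_Z Pi eta).
Proof.
apply: root_space_sum_directv; apply/fdisjointP => a.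
by rewrite !in_fsetD in_fsetU negb_or => /andP[/andP[]].
Qed.

Lemma directv_g1_gZdag Pi eta : directv (g_1 Pi eta + g_Zdag Pi eta).
Proof.
apply: root_space_sum_directv; apply/fdisjointP => a.
by rewrite !in_fsetD in_fsetU negb_or => /andP[/andP[]].
Qed.

End Roots.
End LieAlgebras.

Arguments lie_simple {F} g.

(* Main.v *)
Require Import Defs.
From HB Require Import structures.
From mathcomp Require Import all_boot all_order all_algebra.
From mathcomp Require Import finmap zify.
From mathcomp Require Import boolp reals complex.

(* The root spaces of the statement are honest eigenspaces of h, which is only
   assumed nilpotent and self-normalizing, so one works first with the
   generalized weight spaces W_a of h on g. They decompose g, W_0 = h, and every
   weight is the weight of a genuine eigenvector (Engel). If the Killing form were
   zero, then for t in [W_a, W_-a] the vanishing of tr(ad t) along a-strings would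
   make all weights real multiples of a at t, and killing t t = 0 would make all of
   them vanish; then g = [g, g] gives g = h, contradicting nilpotency. Hence the
   Killing form of a simple g is nondegenerate and the roots are closed under
   negation.

   A root vector of eta generates g under the nonpositive part, so every root is
   at most eta. If eta were simple it would be the only simple root, and a nonzero
   element of h killed by eta (rank at least 2) would lie in the Killing radical.

   Consequently the difference of two elements of Zdag is never a root, and the
   sum of two elements of Zdag is neither 0 nor in Zdag; the inclusions follow
   from [g_a, g_b] <= g_(a + b). *)

Set Implicit Arguments.
Unset Strict Implicit.
Unset Printing Implicit Defensive.

Import Order.TTheory GRing.Theory Num.Theory passmx.
Local Open Scope ring_scope.

(** * Subspaces and traces *)

Section PredSubspace.
Variables (F : fieldType) (vT : vectType F).
Implicit Types (P : vT -> Prop) (U : {vspace vT}).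

Definition subspace_pred P :=
  P 0 /\ forall (a : F) x y, P x -> P y -> P (a *: x + y).

(** A subspace of maximal dimension inside [P] absorbs every [x] satisfying [P]: adjoining the line
    of [x] stays inside [P]. *)
Lemma subspace_pred_vspace P :
  subspace_pred P -> exists U, forall x, x \in U <-> P x.
Proof.
move=> [P0 PD].
pose Q n := `[< exists2 U, \dim U = n & forall x, x \in U -> P x >].
have exQ : exists n, Q n.
  exists 0%N; apply/asboolP; exists 0%VS; first exact: dimv0.
  by move=> x; rewrite memv0 => /eqP->.
have leQ n : Q n -> (n <= \dim {:vT})%N.
  by case/asboolP => U <- _; apply/dimvS/subvf.
case: (ex_maxnP exQ leQ) => n /asboolP[U dU UP] max.
exists U => x; split=> [/UP//|Px].
have /max: Q (\dim (U + <[x]>)).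
  apply/asboolP; exists (U + <[x]>)%VS => // z.
  case/memv_addP => u Uu [_ /vlineP[c ->] ->].
  by rewrite addrC; apply: PD => //; apply: UP.
rewrite -dU => le_dim.
have /eqP-> : U == (U + <[x]>)%VS by rewrite eqEdim addvSl.
by rewrite (subvP (addvSr _ _)) // memv_line.
Qed.

(** The value 0 is a default, taken when no subspace represents [P]. *)
Definition vspace_of P : {vspace vT} :=
  if pselect (exists U, forall x, x \in U <-> P x) is left e
  then projT1 (cid e) else 0%VS.

Lemma vspace_ofP P x : subspace_pred P -> x \in vspace_of P <-> P x.
Proof.
move=> /subspace_pred_vspace ex; rewrite /vspace_of.
by case: pselect => // e; case: (cid e) => U /=.
Qed.

End PredSubspace.

(** * Traces, eigenvalues and eigenvectors of endomorphisms *)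

Section Trace.
Variables (F : numClosedFieldType) (vT : vectType F).
Implicit Types (f : 'End(vT)) (U V : {vspace vT}).

Definition ltrace f : F := \tr (mxof (vbasis {:vT}) (vbasis {:vT}) f).

Lemma ltrace_is_linear : linear (ltrace : 'End(vT) -> F^o).
Proof. by move=> a f e; rewrite /ltrace linearP /= linearP. Qed.

HB.instance Definition _ :=
  GRing.isLinear.Build F 'End(vT) F^o *:%R ltrace ltrace_is_linear.

Lemma ltrace_sum I (r : seq I) (P : pred I) (f : I -> 'End(vT)) :
  ltrace (\sum_(i <- r | P i) f i) = \sum_(i <- r | P i) ltrace (f i).
Proof. exact: (linear_sum ltrace). Qed.

Lemma ltrace_comp f e : ltrace (f \o e)%VF = ltrace (e \o f)%VF.
Proof.
have B := vbasisP {:vT}.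
by rewrite /ltrace !(mxof_comp _ _ B) mxtrace_mulC.
Qed.

(** [rs] lists the roots of the characteristic polynomial with multiplicity; the trace is minus its
    subleading coefficient. *)
Lemma ltrace_eigenvalues f : exists2 rs : seq F,
  ltrace f = \sum_(r <- rs) r
  & forall r, r \in rs <-> exists2 v, v != 0 & f v = r *: v.
Proof.
rewrite /ltrace; set M := mxof _ _ f; have B := vbasisP {:vT}.
have [rs] := closed_field_poly_normal (char_poly M).
rewrite (monicP (char_poly_monic M)) scale1r => Ers; exists rs.
  have sz : size rs = \dim {:vT}.
    by apply: succn_inj; rewrite -(size_char_poly M) Ers size_prod_XsubC.
  (* In dimension 0 there is no subleading coefficient, so that case is done by hand. *)
  have [dim0|dim_gt0] := posnP (\dim {:vT}).
    rewrite /mxtrace big1; last by move=> i; have := ltn_ord i; rewrite {2}dim0.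
    by move: sz; rewrite dim0 => /size0nil->; rewrite big_nil.
  apply: oppr_inj; rewrite -(char_poly_trace _ dim_gt0) Ers -sz.
  by rewrite coefPn_prod_XsubC // sz -lt0n.
move=> r; rewrite -root_prod_XsubC -Ers -eigenvalue_root_char.
split=> [/eigenvalueP[u uM nz_u]|[v nz_v fv]].
  exists (vecof (vbasis {:vT}) u).
    by rewrite (vecof_eq0 B).
  by rewrite (hom_vecof _ B) uM linearZ.
apply/eigenvalueP; exists (rVof (vbasis {:vT}) v).
  by rewrite -(rVof_app _ B) fv linearZ.
by rewrite (rVof_eq0 B).
Qed.

Lemma ltrace_eq0 f :
  (forall r v, v != 0 -> f v = r *: v -> r = 0) -> ltrace f = 0.
Proof.
move=> f0; have [rs -> rsP] := ltrace_eigenvalues f.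
by rewrite big_seq big1 // => r /rsP[v nz_v /f0->].
Qed.

(** The eigenvalues are 0 or 1, so the trace counts the ones; a nonzero value of [f] is an
    eigenvector for 1. *)
Lemma ltrace_idem f : (forall x, f (f x) = f x) -> f != 0 ->
  exists2 n : nat, (0 < n)%N & ltrace f = n%:R.
Proof.
move=> ff nz_f; have [rs -> rsP] := ltrace_eigenvalues f.
have rs01 r : r \in rs -> r = (r == 1)%:R.
  case/rsP => v nz_v fv; have := ff v.
  rewrite fv linearZ /= fv scalerA => /eqP.
  rewrite -subr_eq0 -scalerBl scaler_eq0 (negPf nz_v) orbF.
  rewrite -{3}[r]mulr1 -mulrBr mulf_eq0 subr_eq0 => /orP[/eqP->|/eqP->].
    by rewrite eq_sym oner_eq0.
  by rewrite eqxx.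
exists (count_mem 1 rs).
  have [x nz_fx] : exists x, f x != 0.
    apply: contrapT => f0; case/eqP: nz_f; apply/lfunP => x.
    by rewrite zero_lfunE; apply/eqP/negPn/negP => fx; apply: f0; exists x.
  rewrite -has_count has_pred1; apply/rsP.
  by exists (f x); rewrite // ff scale1r.
elim: rs {rsP} rs01 => [|r rs IH] rs01; first by rewrite big_nil.
rewrite big_cons IH /= ?natrD; last by move=> s rs_s; apply: rs01; rewrite inE rs_s orbT.
by rewrite -rs01 ?mem_head.
Qed.

(** Trace argument that avoids restricting [f] to [V]. Without an eigenvector in [V], both [f] and
    [f + 1], composed with the projection to [V], have only the eigenvalue 0 and hence trace 0.
    Their difference is the projection, of positive trace. *)
Lemma stable_eigenvector f V : (f @: V <= V)%VS -> V != 0%VS ->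
  exists2 v, v \in V & v != 0 /\ exists r, f v = r *: v.
Proof.
move=> fV nzV; apply: contrapT => no_eig.
have tr0 (e : 'End(vT)) (c : F) :
    (forall x, e x = f x + c *: x) -> ltrace (e \o projv V) = 0.
  move=> eE; apply: ltrace_eq0 => r v nz_v.
  rewrite comp_lfunE /= => ev; have [//|nz_r] := eqVneq r 0.
  have Vv : v \in V.
    rewrite -[v]scale1r -(mulVf nz_r) -scalerA -ev memvZ // eE.
    by rewrite memvD ?memvZ ?memv_proj // (subvP fV) // memv_img // memv_proj.
  case: no_eig; exists v => //; split=> //; exists (r - c).
  by rewrite scalerBl -ev projv_id // eE addrK.
have [n n_gt0] : exists2 n : nat, (0 < n)%N & ltrace (projv V) = n%:R.
  apply: ltrace_idem => [x|]; first exact: projv_proj.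
  by apply: contraNneq nzV => p0; rewrite -(limg_proj V) p0 lim0g.
have -> : projv V = ((f + \1) \o projv V)%VF - (f \o projv V)%VF.
  apply/lfunP => x; rewrite add_lfunE opp_lfunE !comp_lfunE add_lfunE id_lfunE.
  by rewrite addrAC subrr add0r.
rewrite linearB /= (tr0 _ 1) ?(tr0 _ 0) => [|x|x]; last 2 first.
- by rewrite scale0r addr0.
- by rewrite scale1r add_lfunE id_lfunE.
by move/esym/eqP; rewrite subrr pnatr_eq0 => /eqP n0; rewrite n0 in n_gt0.
Qed.

(** A complement [C] of [U] in [V] stands for the quotient: an eigenvector of [f] followed by the
    projection to [C] along [U] is an eigenvector modulo [U]. *)
Lemma stable_quotient_eigenvector f U V :
    (f @: V <= V)%VS -> ~~ (V <= U)%VS -> (U <= V)%VS ->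
  exists2 x, x \in V & x \notin U /\ exists r, f x - r *: x \in U.
Proof.
move=> fV nVU UV; pose C := (V :\: U)%VS.
have CU : (C :&: U = 0)%VS by exact: capv_diff.
have VE : (C + U = V)%VS by rewrite /C addv_diff; apply/addv_idPl.
have CV : (C <= V)%VS by exact: diffvSl.
have nzC : C != 0%VS by rewrite diffv_eq0.
pose e := (daddv_pi C U \o f)%VF.
have [|v Cv [nz_v [r ev]]] := @stable_eigenvector e C _ nzC.
  by apply/subvP => _ /memv_imgP[x _ ->]; rewrite comp_lfunE memv_pi.
exists v; first exact: (subvP CV).
split.
  apply: contraNN nz_v => Uv; rewrite -memv0 -CU memv_cap Cv Uv //.
exists r; have fv : f v \in (C + U)%VS.
  by rewrite VE (subvP fV) // memv_img // (subvP CV).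
rewrite -ev /e comp_lfunE -{1}(daddv_pi_add CU fv) addrAC subrr add0r.
exact: memv_pi.
Qed.

End Trace.

(** * Generalized eigenspaces *)

Section GenEigen.
Variables (F : fieldType) (vT : vectType F).
Implicit Types (f : 'End(vT)) (U V : {vspace vT}) (x y : vT).

Definition shift f (c : F) : 'End(vT) := f - c *: \1%VF.

Lemma shiftE f c x : shift f c x = f x - c *: x.
Proof. by rewrite add_lfunE opp_lfunE scale_lfunE id_lfunE. Qed.

Lemma shiftC f c d x : shift f c (shift f d x) = shift f d (shift f c x).
Proof.
rewrite !shiftE !linearB !linearZ /= !scalerA [c * d]mulrC.
by rewrite !addrA; congr (_ + _); rewrite addrAC.
Qed.

Lemma iter_shiftC f c d n x :
  iter n (shift f d) (shift f c x) = shift f c (iter n (shift f d) x).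
Proof. by elim: n => //= n ->; rewrite shiftC. Qed.

Lemma iter_lfun_linear f n : linear (iter n f).
Proof. by elim: n => [|n IHn] a x y //=; rewrite IHn linearP. Qed.

Lemma iter_lfun0 f n : iter n f 0 = 0.
Proof. by elim: n => //= n ->; rewrite linear0. Qed.

Definition gen_eigen f c x := exists n, iter n (shift f c) x = 0.

Lemma gen_eigen_subspace f c : subspace_pred (gen_eigen f c).
Proof.
split=> [|a x y [m xm] [n yn]]; first by exists 0%N.
exists (m + n)%N; rewrite iter_lfun_linear [X in _ + X]iterD yn iter_lfun0 addr0.
by rewrite addnC iterD xm iter_lfun0 scaler0.
Qed.

Definition gen_eigenspace f c : {vspace vT} := vspace_of (gen_eigen f c).

Lemma gen_eigenspaceP f c x : x \in gen_eigenspace f c <-> gen_eigen f c x.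
Proof. exact/vspace_ofP/gen_eigen_subspace. Qed.

Lemma gen_eigen_shift f c d x : gen_eigen f c x -> gen_eigen f c (shift f d x).
Proof.
by case=> n xn; exists n; rewrite iter_shiftC xn linear0.
Qed.

Lemma gen_eigen_unshift f c x : gen_eigen f c (shift f c x) -> gen_eigen f c x.
Proof. by case=> n xn; exists n.+1; rewrite iterSr. Qed.

(** Induction on the sum of the two exponents: both shifts of [x] satisfy the same hypotheses with a
    smaller sum, so they vanish, and their difference is a nonzero multiple of [x]. *)
Lemma gen_eigen_uniq f c d x :
  gen_eigen f c x -> gen_eigen f d x -> c != d -> x = 0.
Proof.
move=> [m xm] [n xn] ncd; move: {2}(m + n)%N (leqnn (m + n)) => k.
elim: k m n x xm xn => [|k IHk] [|m] [|n] x //= xm xn; rewrite ?addSn ?addnS ?ltnS => le_k.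
have xc : shift f c x = 0.
  apply: (IHk m n.+1); [by rewrite -iterSr | | by rewrite addnS].
  by rewrite iter_shiftC /= xn linear0.
have xd : shift f d x = 0.
  apply: (IHk m.+1 n); [ | by rewrite -iterSr | by rewrite addSn].
  by rewrite iter_shiftC /= xm linear0.
move: xd; rewrite -[RHS]xc !shiftE => /addrI/oppr_inj/eqP.
by rewrite -subr_eq0 -scalerBl scaler_eq0 subr_eq0 eq_sym (negPf ncd) => /eqP.
Qed.

End GenEigen.

Section GenEigenDecomposition.
Variables (F : numClosedFieldType) (vT : vectType F).
Implicit Types (f : 'End(vT)) (U V : {vspace vT}) (x y : vT).

(** The shift by [r] is injective there by [gen_eigen_uniq], hence onto by dimension. *)
Lemma shift_gen_eigenspace_surj f V c r : (f @: V <= V)%VS -> c != r ->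
  (shift f r @: (V :&: gen_eigenspace f c) = V :&: gen_eigenspace f c)%VS.
Proof.
move=> fV ncr; apply/eqP; rewrite eqEdim limg_dim_eq ?leqnn ?andbT; last first.
  apply/eqP; rewrite -subv0; apply/subvP => x; rewrite memv0 !memv_cap memv_ker.
  move=> /andP[/andP[_ /gen_eigenspaceP xc] /eqP xr]; apply/eqP.
  by apply: (gen_eigen_uniq xc _ ncr); exists 1%N.
apply/subvP => _ /memv_imgP[x /[!memv_cap]/andP[Vx /gen_eigenspaceP xc] ->].
apply/andP; split; last exact/gen_eigenspaceP/gen_eigen_shift.
by rewrite shiftE memvB ?memvZ // (subvP fV) // memv_img.
Qed.

(** A list [s] with sum of maximal dimension works. Otherwise an eigenvector [x] modulo the sum,
    with eigenvalue [r], can be corrected within the sum to a generalized eigenvector for [r],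
    contradicting maximality. *)
Lemma gen_eigenspace_sum f V : (f @: V <= V)%VS ->
  exists s : seq F, V = (\sum_(c <- s) (V :&: gen_eigenspace f c))%VS.
Proof.
move=> fV; pose US (s : seq F) := (\sum_(c <- s) (V :&: gen_eigenspace f c))%VS.
have USV s : (US s <= V)%VS.
  by rewrite /US big_tnth; apply/subv_sumP => i _; apply: capvSl.
pose Q n := `[< exists s, \dim (US s) = n >].
have exQ : exists n, Q n by exists (\dim (US [::])); apply/asboolP; exists [::].
have leQ n : Q n -> (n <= \dim V)%N by case/asboolP => s <-; apply: dimvS.
case: (ex_maxnP exQ leQ) => n /asboolP[s ds] max; exists s.
apply/eqP; rewrite eqEsubv -/(US s) USV andbT; apply/negPn/negP => nVU.
have [x Vx [nUx [r Ufx]]] := stable_quotient_eigenvector fV nVU (USV s).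
(* Components for eigenvalues other than [r] are images under the shift by [r]; the component for
   [r] is left as the error. *)
have lift u t : u \in US t ->
    exists2 w, w \in US t & shift f r w - u \in gen_eigenspace f r.
  elim: t u => [|c t IHt] u.
    rewrite /US big_nil memv0 => /eqP->; exists 0; rewrite ?mem0v //.
    by rewrite linear0 subr0 mem0v.
  rewrite /US big_cons => /memv_addP[u1 u1c [u2 /IHt[w2 w2t w2P] ->]].
  have [Ecr|ncr] := eqVneq c r.
    exists w2; first by rewrite (subvP (addvSr _ _)).
    move: u1c; rewrite Ecr memv_cap => /andP[_ u1r].
    by rewrite opprD addrCA memvD ?memvN.
  have [w1 w1c ->] : exists2 w1, w1 \in (V :&: gen_eigenspace f c)%VS
      & u1 = shift f r w1.
    by apply/memv_imgP; rewrite (shift_gen_eigenspace_surj fV ncr).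
  exists (w1 + w2); first by rewrite memv_add.
  by rewrite linearD opprD addrACA subrr add0r.
have [w Uw wP] := lift _ _ Ufx.
have Vxw : x - w \in (V :&: gen_eigenspace f r)%VS.
  rewrite memv_cap memvB ?(subvP (USV s) w Uw) //=.
  apply/gen_eigenspaceP/gen_eigen_unshift/gen_eigenspaceP.
  by rewrite linearB /= -opprB memvN [X in _ - X]shiftE.
have EU : US s == US (r :: s).
  rewrite eqEdim ds max ?andbT; first by rewrite /US big_cons addvSr.
  by apply/asboolP; exists (r :: s).
by case/negP: nUx; rewrite (eqP EU) -[x](subrK w) /US big_cons memv_add.
Qed.

End GenEigenDecomposition.

(** * The bracket and generalized eigenvectors *)

Section LieBasics.
Variables (F : fieldType) (g : lieAlgType F).
Implicit Types (x y z u v : g) (h A U V : {vspace g}).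

Lemma lieb_anti x y : lieb x y = - lieb y x.
Proof.
apply/eqP; rewrite -addr_eq0; have := liebb (x + y).
by rewrite liebDl !linearD /= !liebb add0r addr0 => ->.
Qed.

Lemma liebBl x y z : lieb (x - y) z = lieb x z - lieb y z.
Proof. by rewrite -scaleN1r liebDl liebZl scaleN1r. Qed.

Lemma liebDr x y z : lieb x (y + z) = lieb x y + lieb x z.
Proof. exact: linearD. Qed.

Lemma liebBr x y z : lieb x (y - z) = lieb x y - lieb x z.
Proof. exact: linearB. Qed.

Lemma liebZr c x y : lieb x (c *: y) = c *: lieb x y.
Proof. exact: linearZ. Qed.

Lemma lieb_der x y z : lieb x (lieb y z) = lieb (lieb x y) z + lieb y (lieb x z).
Proof.
have := lieb_jacobi x y z; rewrite (lieb_anti z (lieb x y)) (lieb_anti z x) linearN /=.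
by move=> /eqP; rewrite subr_eq0 => /eqP <-; rewrite subrK.
Qed.

(** Leibniz rule: shifting the bracket by [c + d] is the sum of shifting [u] by [c] and shifting [v]
    by [d], and each term lowers one exponent. *)
Lemma gen_eigen_lieb y c d u v : gen_eigen (ad y) c u -> gen_eigen (ad y) d v ->
  gen_eigen (ad y) (c + d) (lieb u v).
Proof.
move=> [m um] [n vn]; exists (m + n)%N; move: {2}(m + n)%N (leqnn (m + n)) => k.
elim: k m n u v um vn => [|k IHk] [|m] [|n] u v //=.
- by move=> -> _; rewrite lieb0l.
- by move=> -> _ _; rewrite lieb0l.
- by move=> -> _ _; rewrite lieb0l iter_lfun0 linear0.
- by move=> _ -> _; rewrite linear0 addn0 iter_lfun0 linear0.
rewrite -!iterS !iterSr => um vn; rewrite ?addSn ?addnS ltnS => le_k.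
have -> : shift (ad y) (c + d) (lieb u v)
    = 1 *: lieb (shift (ad y) c u) v + lieb u (shift (ad y) d v).
  rewrite scale1r !shiftE !adE lieb_der liebBl liebZl liebBr.
  by rewrite liebZr scalerDl opprD addrACA.
rewrite (iter_lfun_linear _ (m + n).+1).
have -> : iter (m + n).+1 (shift (ad y) (c + d)) (lieb (shift (ad y) c u) v) = 0.
  by rewrite -addnS; apply: IHk; rewrite ?iterSr ?addnS.
have -> : iter (m + n).+1 (shift (ad y) (c + d)) (lieb u (shift (ad y) d v)) = 0.
  by rewrite -addSn; apply: IHk; rewrite ?iterSr ?addSn.
by rewrite scaler0 addr0.
Qed.

End LieBasics.

(** * Nilpotent subalgebras *)

Section Projections.
Variables (F : numClosedFieldType) (vT : vectType F).
Implicit Types (f p : 'End(vT)) (V : {vspace vT}).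

(** The complement is left free, so that [projv] and the projections along a weight decomposition
    are both covered. *)
Definition projects_on p V := (forall x, p x \in V) /\ (forall x, x \in V -> p x = x).

Lemma projv_projects V : projects_on (projv V) V.
Proof. by split=> x; [exact: memv_proj | exact: projv_id]. Qed.

Lemma ltrace_projection p V : projects_on p V -> V != 0%VS ->
  exists2 n : nat, (0 < n)%N & ltrace p = n%:R.
Proof.
move=> [pV pid] nzV; apply: ltrace_idem => [x|]; first by rewrite pid.
apply: contraNneq nzV => p0; rewrite -subv0; apply/subvP => x Vx.
by rewrite -(pid x Vx) p0 zero_lfunE mem0v.
Qed.

(** On [V] the shift of [f] by [c] is nilpotent, so after [p] it has only the eigenvalue 0. *)
Lemma ltrace_gen_eigen f p V c : projects_on p V -> (f @: V <= V)%VS ->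
    (forall x, x \in V -> gen_eigen f c x) ->
  ltrace (f \o p)%VF = c * ltrace p.
Proof.
move=> [pV pid] fV fc.
suff : ltrace (shift f c \o p)%VF = 0.
  have -> : (shift f c \o p)%VF = (f \o p)%VF - c *: p.
    apply/lfunP => x.
    by rewrite comp_lfunE shiftE add_lfunE opp_lfunE scale_lfunE comp_lfunE.
  by rewrite linearB linearZ /= => /eqP; rewrite subr_eq0 => /eqP.
apply: ltrace_eq0 => r v nz_v; rewrite comp_lfunE => fv.
have [//|nz_r] := eqVneq r 0.
have Vv : v \in V.
  rewrite -[v]scale1r -(mulVf nz_r) -scalerA -fv memvZ // shiftE.
  by rewrite memvB ?memvZ // (subvP fV) // memv_img.
have [n] := fc v Vv; rewrite pid // in fv.
have -> : iter n (shift f c) v = r ^+ n *: v.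
  elim: n => [|n IHn]; first by rewrite scale1r.
  by rewrite iterS IHn linearZ /= fv scalerA exprSr.
by move/eqP; rewrite scaler_eq0 (negPf nz_v) orbF expf_eq0 (negPf nz_r) andbF.
Qed.

(** Stability of [V] allows a second [p] between the two factors; then the trace is cyclic. *)
Lemma ltrace_commutator_stable e f p V : projects_on p V ->
    (e @: V <= V)%VS -> (f @: V <= V)%VS ->
  ltrace ((e \o f) \o p)%VF = ltrace ((f \o e) \o p)%VF.
Proof.
move=> [pV pid] eV fV.
have absorb (a b : 'End(vT)) : (b @: V <= V)%VS ->
    ((a \o b) \o p)%VF = ((a \o p) \o (b \o p))%VF.
  move=> bV; apply/lfunP => x; rewrite !comp_lfunE (pid (b (p x))) //.
  by rewrite (subvP bV) // memv_img.
by rewrite !absorb // ltrace_comp.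
Qed.

(** The shift of the square factors as (f + c)(f - c), with commuting factors. *)
Lemma gen_eigen_sqr f c x : gen_eigen f c x -> gen_eigen (f \o f)%VF (c * c) x.
Proof.
move=> [n xn]; exists n.
have -> : iter n (shift (f \o f)%VF (c * c)) x
        = iter n (shift f (- c)) (iter n (shift f c) x).
  elim: n {xn} => //= n ->; rewrite iter_shiftC [LHS]shiftE [RHS]shiftE shiftE.
  rewrite comp_lfunE (linearB f) /= [f (_ *: _)]linearZ /= scaleNr opprK scalerBr scalerA.
  by rewrite addrA subrK.
by rewrite xn iter_lfun0.
Qed.

End Projections.

(** * Engel's theorem relative to a stable subspace *)

Section Nilpotent.
Variables (F : fieldType) (g : lieAlgType F).
Implicit Types (x y z : g) (h A U V : {vspace g}).

Definition lie_stable h V := forall y x, y \in h -> x \in V -> lieb y x \in V.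

Lemma lie_stable_img h V y : lie_stable h V -> y \in h -> (ad y @: V <= V)%VS.
Proof.
by move=> sV hy; apply/subvP => _ /memv_imgP[x Vx ->]; rewrite adE sV.
Qed.

Lemma lie_subalgebraP h : lie_subalgebra h -> lie_stable h h.
Proof. by move/liebvP => sh y x; apply: sh. Qed.

Lemma lie_nilpotent_ad h y z : lie_nilpotent h -> y \in h -> z \in h ->
  gen_eigen (ad y) 0 z.
Proof.
move=> [n hn] hy hz; exists n; apply/eqP; rewrite -memv0 -hn.
elim: n {hn} => //= n IHn; rewrite shiftE scale0r subr0 adE.
exact: (liebvP _ _ _ (subvv _)).
Qed.

Lemma shift_ad_commutator y z c d x :
  shift (ad y) c (shift (ad z) d x)
    = shift (ad z) d (shift (ad y) c x) + lieb (lieb y z) x.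
Proof.
rewrite !shiftE !adE !liebBr !liebZr lieb_der !scalerBr !scalerA [c * d]mulrC !opprB.
rewrite [RHS]addrC !addrA [LHS]addrAC [RHS]addrAC; congr (_ + _).
by rewrite addrAC.
Qed.

(* Among the h-stable spaces strictly between A and U a minimal one V satisfies
   (ad y - lam y) V <= A for all y, by descending induction along the lower
   central series. *)
Lemma engel_quotient h A U (lam : g -> F) :
    lie_subalgebra h -> lie_nilpotent h ->
    (forall y z, y \in h -> z \in h -> lam (lieb y z) = 0) ->
    lie_stable h A -> lie_stable h U -> (A <= U)%VS -> ~~ (U <= A)%VS ->
    (forall y x, y \in h -> x \in U -> gen_eigen (ad y) (lam y) x) ->
  exists2 x, x \in U & x \notin A /\
    forall y, y \in h -> lieb y x - lam y *: x \in A.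
Proof.
move=> /lie_subalgebraP hh [n hn] lam0 hA hU AU nUA hgen.
pose good V := [/\ (A <= V)%VS, ~~ (V <= A)%VS, (V <= U)%VS & lie_stable h V].
pose Q k := `[< exists2 V, \dim V = k & good V >].
have exQ : exists k, Q k by exists (\dim U); apply/asboolP; exists U.
case: (ex_minnP exQ) => k /asboolP[V dV [AV nVA VU hV]] min.
have shiftA y x : y \in h -> x \in A -> shift (ad y) (lam y) x \in A.
  by move=> hy Ax; rewrite shiftE adE memvB ?memvZ ?hA.
have shiftV y x : y \in h -> x \in V -> shift (ad y) (lam y) x \in V.
  by move=> hy Vx; rewrite shiftE adE memvB ?memvZ ?hV.
have Ck j : (iter j (liebv h) h <= h)%VS.
  elim: j => //= j IHj; apply/liebvP => u v hu /(subvP IHj); exact: hh.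
(* For [j = 0] only [y = 0] occurs; [j = n] covers all of [h]. Beyond [n] the truncated subtraction
   is constant. *)
have key j : forall y x, y \in iter (n - j) (liebv h) h -> x \in V ->
    shift (ad y) (lam y) x \in A.
  elim: j => [|j IHj] y x.
    rewrite subn0 hn memv0 => /eqP-> Vx.
    have -> : lam 0 = 0 by rewrite -(liebb 0) lam0 ?mem0v.
    by rewrite shiftE adE lieb0l scale0r subrr mem0v.
  have [lt_jn|le_nj] := ltnP j n; last first.
    suff -> : (n - j.+1 = n - j)%N by exact: IHj.
    by rewrite (eqnP le_nj); apply/eqP; rewrite subn_eq0 ltnW.
  move=> Cy Vx; have hy := subvP (Ck _) _ Cy.
  have IHz z : z \in h -> lieb y z \in iter (n - j) (liebv h) h.
    move=> hz; rewrite -memvN -lieb_anti -(subnSK lt_jn) /=.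
    exact: (liebvP _ _ _ (subvv _)).
  (* [Vy] is [h]-stable because the commutator term of [shift_ad_commutator] is covered by the
     induction hypothesis; minimality of [V] then forces equality. *)
  pose Vy := (V :&: (shift (ad y) (lam y) @^-1: A))%VS.
  suff : V == Vy.
    by move/eqP => EV; move: Vx; rewrite EV memv_cap -memv_preim => /andP[].
  rewrite eq_sym eqEdim capvSl dV; apply: min; apply/asboolP; exists Vy => //.
  split.
  - apply/subvP => z Az; rewrite memv_cap (subvP AV) //= -memv_preim.
    exact: shiftA.
  (* The last iterate of the shift on [z] that is still outside [A] belongs to [Vy]. *)
  - have [z Vz nAz] := subvPn nVA.
    have exm : exists m, iter m (shift (ad y) (lam y)) z \in A.
      have [m zm] := hgen y z hy (subvP VU z Vz).
      by exists m; rewrite zm mem0v.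
    case: (ex_minnP exm) => [[|m]] zm minm; first by rewrite zm in nAz.
    apply/subvPn; exists (iter m (shift (ad y) (lam y)) z).
      rewrite memv_cap -memv_preim zm andbT.
      by elim: m {zm minm} => //= m; apply: shiftV.
    by apply/negP => /minm; rewrite ltnn.
  - exact: subv_trans (capvSl _ _) VU.
  move=> z v hz; rewrite !memv_cap -!memv_preim => /andP[Vv Av].
  rewrite hV //=.
  have -> : lieb z v = shift (ad z) (lam z) v + lam z *: v.
    by rewrite shiftE adE subrK.
  rewrite linearD linearZ /= shift_ad_commutator memvD ?memvZ // memvD ?(shiftA z) //.
  by have := IHj _ _ (IHz z hz) Vv; rewrite shiftE adE lam0 // scale0r subr0.
have [x Vx nAx] := subvPn nVA; exists x; first exact: (subvP VU).
split=> // y hy; have := key n y x; rewrite subnn shiftE adE; exact.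
Qed.

End Nilpotent.

(** * Generalized weight spaces *)

Section Weights.
Variables (F : numClosedFieldType) (g : lieAlgType F) (h : {vspace g}).
Hypothesis (h_sub : lie_subalgebra h) (h_nil : lie_nilpotent h).
Implicit Types (a b : dual h) (x y z u v : g) (V W : {vspace g}).

(** Extending [a] to all of [g] through the projection avoids carrying membership proofs; only
    values on [h] have a meaning. *)
Definition ev a y : F := a (vsproj h y).

Lemma ev_linear a : linear (ev a : g -> F^o).
Proof. by move=> c x y; rewrite /ev !linearP. Qed.

HB.instance Definition _ a :=
  GRing.isLinear.Build F g F^o *:%R (ev a) (ev_linear a).

Lemma evD a b y : ev (a + b) y = ev a y + ev b y.
Proof. by rewrite /ev add_lfunE. Qed.

Lemma evN a y : ev (- a) y = - ev a y.
Proof. by rewrite /ev opp_lfunE. Qed.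

Lemma evMn a n y : ev (a *+ n) y = ev a y *+ n.
Proof. by elim: n => [|n IHn]; rewrite ?mulrS ?evD ?IHn // /ev zero_lfunE. Qed.

Lemma ev0 y : ev 0 y = 0.
Proof. by rewrite /ev zero_lfunE. Qed.

Lemma ev_val a (y : subvs_of h) : ev a (vsval y) = a y.
Proof. by rewrite /ev vsvalK. Qed.

Lemma ev_inj a b : (forall y, y \in h -> ev a y = ev b y) -> a = b.
Proof. by move=> E; apply/lfunP => y; rewrite -!ev_val E // subvsP. Qed.

Definition weight_vector a x := forall y, y \in h -> gen_eigen (ad y) (ev a y) x.

Lemma weight_vector_subspace a : subspace_pred (weight_vector a).
Proof.
by split=> [|c x z xa za] y hy; apply gen_eigen_subspace; [exact: xa | exact: za].
Qed.

Definition weight_space a : {vspace g} := vspace_of (weight_vector a).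

Lemma weight_spaceP a x : x \in weight_space a <-> weight_vector a x.
Proof. exact/vspace_ofP/weight_vector_subspace. Qed.

Lemma weight_space_lieb a b u v :
  u \in weight_space a -> v \in weight_space b -> lieb u v \in weight_space (a + b).
Proof.
move=> /weight_spaceP ua /weight_spaceP vb; apply/weight_spaceP => y hy.
by rewrite evD; apply: gen_eigen_lieb; [exact: ua | exact: vb].
Qed.

Lemma sub_weight_space0 : (h <= weight_space 0%R)%VS.
Proof.
by apply/subvP => z hz; apply/weight_spaceP => y hy; rewrite ev0; apply: lie_nilpotent_ad hz.
Qed.

Lemma root_space_weight_space a : (root_space a <= weight_space a)%VS.
Proof.
apply/subvP => x /root_spaceP xa; apply/weight_spaceP => y hy; exists 1%N.
have xy := xa (Subvs hy); rewrite -ev_val /= in xy.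
by rewrite /= shiftE adE xy subrr.
Qed.

Lemma weight_space_stable a : lie_stable h (weight_space a).
Proof.
by move=> y x /(subvP sub_weight_space0) hy xa; rewrite -[a]add0r weight_space_lieb.
Qed.

(** A power of the shift by b(y) kills [f b], and by induction every other term too. If [y]
    separates [a] from [b], then [f a] is a generalized eigenvector for two eigenvalues. *)
Lemma weight_space_indep (s : seq (dual h)) (f : dual h -> g) : uniq s ->
  (forall a, a \in s -> f a \in weight_space a) ->
  \sum_(a <- s) f a = 0 -> forall a, a \in s -> f a = 0.
Proof.
elim: s f => [|b s IHs] f //= /andP[bNs us] fs; rewrite big_cons => f0.
have fs0 a : a \in s -> f a = 0.
  move=> as_; have fa := proj1 (weight_spaceP _ _) (fs a _).
  have [y hy nab] : exists2 y, y \in h & ev a y != ev b y.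
    apply: contrapT => no_y; case/negP: bNs; suff <- : a = b by [].
    apply: ev_inj => y hy; apply/eqP/negPn/negP => nab; apply: no_y; by exists y.
  have [n fbn] := proj1 (weight_spaceP _ _) (fs b (mem_head _ _)) y hy.
  pose T := iter n (shift (ad y) (ev b y)).
  have T0 : T 0 = 0 by exact: iter_lfun0.
  have TD u v : T (u + v) = T u + T v.
    by rewrite -[u]scale1r /T iter_lfun_linear !scale1r.
  apply: (@gen_eigen_uniq _ _ (ad y) (ev a y) (ev b y)) => //.
    by apply: fa => //; rewrite inE as_ orbT.
  exists n; apply: (IHs (fun c => T (f c))) => //.
    move=> c cs; have : f c \in weight_space c by rewrite fs // inE cs orbT.
    move: (f c) => z; rewrite /T; elim: n {fbn T T0 TD} => //= n IHn zc.
    by rewrite shiftE adE memvB ?memvZ ?weight_space_stable ?IHn.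
  have := f_equal T f0; rewrite TD [T (f b)]fbn add0r T0 => E; rewrite -[RHS]E.
  by elim: (s) => [|c r IHr]; rewrite ?big_nil ?T0 // !big_cons TD IHr.
move=> a; rewrite inE => /predU1P[->|/fs0 //].
by rewrite -[LHS]addr0 -[RHS]f0 big_seq big1.
Qed.

Lemma ad_lieb y z : ad (lieb y z) = (ad y \o ad z)%VF - (ad z \o ad y)%VF.
Proof.
apply/lfunP => x; rewrite add_lfunE opp_lfunE !comp_lfunE !adE (lieb_der y z x).
by rewrite addrK.
Qed.

Lemma ad_linear : linear (@ad F g).
Proof.
by move=> c x y; apply/lfunP => z; rewrite add_lfunE scale_lfunE !adE liebDl liebZl.
Qed.

HB.instance Definition _ := GRing.isLinear.Build F g 'End(g) *:%R (@ad F g) ad_linear.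

Lemma ltrace_ad_lieb p V y z : projects_on p V ->
    (ad y @: V <= V)%VS -> (ad z @: V <= V)%VS ->
  ltrace (ad (lieb y z) \o p)%VF = 0.
Proof.
move=> pV yV zV; rewrite ad_lieb comp_lfunDl comp_lfunNl linearB /=.
by rewrite (ltrace_commutator_stable pV yV zV) subrr.
Qed.

(** The trace of ad [y, z] on the weight space is 0, as for any commutator, and also a([y, z]) times
    a positive integer. *)
Lemma weight_lieb a y z : weight_space a != 0%VS -> y \in h -> z \in h ->
  ev a (lieb y z) = 0.
Proof.
move=> nza hy hz; have pV := projv_projects (weight_space a).
have sV := @weight_space_stable a.
have [n n_gt0 trn] := ltrace_projection pV nza.
have hyz : lieb y z \in h by apply: (lie_subalgebraP h_sub).
have := ltrace_gen_eigen pV (lie_stable_img sV hyz)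
  (fun x xa => proj1 (weight_spaceP _ _) xa _ hyz).
rewrite (ltrace_ad_lieb pV (lie_stable_img sV hy) (lie_stable_img sV hz)).
move=> /esym/eqP; rewrite mulf_eq0 trn pnatr_eq0 => /orP[/eqP//|/eqP n0].
by rewrite n0 in n_gt0.
Qed.

Lemma primary_weight V : lie_stable h V -> V != 0%VS ->
    (forall y, y \in h -> exists c, forall x, x \in V -> gen_eigen (ad y) c x) ->
  exists a, (V <= weight_space a)%VS.
Proof.
move=> sV nzV prim; have pV := projv_projects V.
have [n n_gt0 trn] := ltrace_projection pV nzV.
(* The single eigenvalue of ad y on [V] is its normalized trace, which makes it linear in [y]. *)
pose lam (y : subvs_of h) : F^o := (n%:R)^-1 *: (ltrace (ad (vsval y) \o projv V)%VF : F^o).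
have lam_lin : linear lam.
  move=> c x y; rewrite /lam.
  have -> : vsval (c *: x + y) = c *: vsval x + vsval y by exact: linearP.
  by rewrite ad_linear comp_lfunDl -comp_lfunZl ltrace_is_linear scalerDr !scalerA mulrC.
pose lamL := GRing.isLinear.Build F _ _ *:%R lam lam_lin.
pose lam' : {linear subvs_of h -> F^o} := HB.pack lam lamL.
exists (linfun lam' : dual h); apply/subvP => x Vx; apply/weight_spaceP => y hy.
have [c cP] := prim y hy.
suff -> : ev (linfun lam') y = c by exact: cP.
rewrite /ev lfunE /= /lam vsprojK // (ltrace_gen_eigen pV (lie_stable_img sV hy) cP) trn.
rewrite /GRing.scale /= mulrC mulfK // pnatr_eq0 -lt0n //.
Qed.

(** Induction on dimension: if some ad y has no single generalized eigenvalue on [V], its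
    generalized eigenspaces cut [V] into smaller pieces, [h]-stable because [h] acts nilpotently on
    [y]. *)
Lemma weight_decomposition V : lie_stable h V ->
  exists s : seq (dual h), (V <= \sum_(a <- s) weight_space a)%VS.
Proof.
have [n] := ubnP (\dim V); elim: n V => // n IHn V le_n sV.
have [->|nzV] := eqVneq V 0%VS; first by exists [::]; rewrite sub0v.
have [prim|] := pselect (forall y, y \in h ->
    exists c, forall x, x \in V -> gen_eigen (ad y) c x).
  by have [a Va] := primary_weight sV nzV prim; exists [:: a]; rewrite big_seq1.
move=> /existsNP[y /not_implyP[hy /forallNP no_c]].
have [s Es] := gen_eigenspace_sum (lie_stable_img sV hy).
suff [r le_r] : exists r : seq (dual h),
    (\sum_(c <- s) (V :&: gen_eigenspace (ad y) c) <= \sum_(a <- r) weight_space a)%VS.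
  by exists r; rewrite {1}Es.
elim: s {Es} => [|c s [r IHr]]; first by exists [::]; rewrite !big_nil.
have [] := IHn (V :&: gen_eigenspace (ad y) c)%VS.
- rewrite -ltnS; apply: leq_trans le_n; rewrite ltnS ltn_neqAle dimvS ?capvSl // andbT.
  apply: contra_notN (no_c c) => Ed x.
  have /eqP <- : (V :&: gen_eigenspace (ad y) c)%VS == V by rewrite eqEdim capvSl (eqP Ed) /=.
  by rewrite memv_cap => /andP[_ /gen_eigenspaceP].
- move=> z x hz; rewrite !memv_cap => /andP[Vx /gen_eigenspaceP xc].
  rewrite sV //=; apply/gen_eigenspaceP; rewrite -[c]add0r.
  by apply: gen_eigen_lieb => //; apply: lie_nilpotent_ad hz.
move=> r' IHr'; exists (r' ++ r); rewrite big_cons big_cat /=.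
exact: addvS.
Qed.

(** [engel_quotient] above the zero subspace yields a genuine eigenvector. *)
Lemma weight_space_root a : weight_space a != 0%VS -> root_space a != 0%VS.
Proof.
move=> nza; have s0 : lie_stable h (0%VS : {vspace g}).
  by move=> y x _; rewrite !memv0 => /eqP->; rewrite linear0.
have nW : ~~ (weight_space a <= 0)%VS by rewrite subv0.
have [|x xa [nz_x xP]] := engel_quotient h_sub h_nil (fun y z => weight_lieb nza) s0
    (@weight_space_stable a) (sub0v _) nW.
  by move=> y x hy /weight_spaceP; apply.
apply: contraNneq nz_x => root0; rewrite -root0; apply/root_spaceP => y.
by have := xP _ (subvsP y); rewrite memv0 subr_eq0 ev_val => /eqP.
Qed.

Hypothesis h_norm : lie_self_normalizing h.

(** If larger than [h], [engel_quotient] above [h] would give an element outside [h] that normalizes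
    [h]. *)
Lemma weight_space0 : weight_space 0 = h.
Proof.
apply/eqP; rewrite eqEsubv sub_weight_space0 andbT; apply/negPn/negP => nW.
have [|x xW [nhx xP]] := engel_quotient (lam := fun=> 0) h_sub h_nil
  (fun _ _ _ _ => erefl) (lie_subalgebraP h_sub) (@weight_space_stable 0)
  sub_weight_space0 nW.
  by move=> y x hy /weight_spaceP /(_ y hy); rewrite ev0.
case/negP: nhx; apply: h_norm => u hu.
by rewrite lieb_anti memvN; have := xP u hu; rewrite scale0r subr0.
Qed.

End Weights.

(** * The Killing form *)

Section SumsOfSubspaces.
Variables (F : fieldType) (vT : vectType F) (I : eqType) (s : seq I) (P : pred I).
Variable W : I -> {vspace vT}.

Lemma sumv_seq_le U : (forall i, i \in s -> P i -> (W i <= U)%VS) ->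
  (\sum_(i <- s | P i) W i <= U)%VS.
Proof.
move=> sub; rewrite big_seq_cond; apply: (big_ind (fun X => X <= U)%VS).
- exact: sub0v.
- by move=> X Y XU YU; rewrite subv_add XU.
by move=> i /andP[]; apply: sub.
Qed.

Lemma sumv_seq_sup i : i \in s -> P i -> (W i <= \sum_(j <- s | P j) W j)%VS.
Proof.
move=> si Pi; rewrite -big_filter (big_rem i) ?addvSl //.
by rewrite mem_filter Pi.
Qed.

End SumsOfSubspaces.

Section Killing.
Variables (F : numClosedFieldType) (g : lieAlgType F).
Implicit Types (x y z u v : g).

Definition killing x y : F := ltrace (ad x \o ad y)%VF.

Lemma killing_linearr x : linear (killing x : g -> F^o).
Proof.
move=> c y z; rewrite /killing ad_linear comp_lfunDr -comp_lfunZr.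
exact: ltrace_is_linear.
Qed.

HB.instance Definition _ x :=
  GRing.isLinear.Build F g F^o *:%R (killing x) (killing_linearr x).

Lemma killingC x y : killing x y = killing y x.
Proof. exact: ltrace_comp. Qed.

Lemma killing_invariant x y z : killing (lieb x y) z = killing y (lieb z x).
Proof.
rewrite /killing !ad_lieb !(comp_lfunDl, comp_lfunDr) !(comp_lfunNl, comp_lfunNr).
rewrite !linearB /= -!comp_lfunA; congr (_ - _).
by rewrite ltrace_comp -comp_lfunA.
Qed.

Definition killing_radical := vspace_of (fun x => forall z, killing x z = 0).

Lemma killing_radicalP x : x \in killing_radical <-> forall z, killing x z = 0.
Proof.
apply: vspace_ofP; split=> [z|a u v u0 v0 z]; first by rewrite killingC linear0.
by rewrite killingC linearP /= !(killingC z) u0 v0 addr0 scaler0.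
Qed.

Lemma killing_radical_ideal : lie_ideal killing_radical.
Proof.
apply/liebvP => u x _ /killing_radicalP x0; apply/killing_radicalP => z.
by rewrite killing_invariant x0.
Qed.

End Killing.

(** * Weights of a Cartan subalgebra and nondegeneracy of the Killing form *)

Section Cartan.
Variables (F : numClosedFieldType) (g : lieAlgType F) (h : {vspace g}).
Hypothesis h_cartan : cartan_subalgebra h.
Hypothesis h_nz : h != 0%VS.
Implicit Types (a b c : dual h) (x y z u v : g) (V : {vspace g}).

Let h_sub : lie_subalgebra h. Proof. by case: h_cartan. Qed.
Let h_nil : lie_nilpotent h. Proof. by case: h_cartan. Qed.
Let h_norm : lie_self_normalizing h. Proof. by case: h_cartan. Qed.
Local Notation W := (@weight_space F g h).

Lemma weights_exist : exists s : seq (dual h),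
  [/\ uniq s, forall a, a \in s -> W a != 0%VS & {:g}%VS = (\sum_(a <- s) W a)%VS].
Proof.
have [|s sP] := @weight_decomposition _ _ _ h_nil fullv; first by move=> *; rewrite memvf.
exists [seq a <- undup s | W a != 0%VS]; split.
- exact/filter_uniq/undup_uniq.
- by move=> a; rewrite mem_filter => /andP[].
apply/eqP; rewrite eqEsubv subvf andbT; apply: subv_trans sP _.
apply: sumv_seq_le => a sa _; have [->|nza] := eqVneq (W a) 0%VS; first exact: sub0v.
by apply: sumv_seq_sup => //; rewrite mem_filter nza mem_undup.
Qed.

(** Unlike [roots], this list contains 0. *)
Definition weights : seq (dual h) := projT1 (cid weights_exist).
Local Notation L := weights.

Lemma weights_uniq : uniq L.
Proof. by rewrite /weights; case: cid => s []. Qed.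

Lemma weights_nz a : a \in L -> W a != 0%VS.
Proof. by rewrite /weights; case: cid => s [] /= _ + _; apply. Qed.

Lemma weights_full : {:g}%VS = (\sum_(a <- L) W a)%VS.
Proof. by rewrite /weights; case: cid => s []. Qed.

Definition wproj a : 'End(g) := sumv_pi_for weights_full a.

Lemma wproj_mem a x : wproj a x \in W a.
Proof. exact: memv_sum_pi. Qed.

Lemma wproj_sum x : \sum_(a <- L) wproj a x = x.
Proof. by apply: sumv_pi_uniq_sum; rewrite ?memvf // filter_predT weights_uniq. Qed.

Lemma mem_weights a : (a \in L) = (W a != 0%VS).
Proof.
apply/idP/idP => [/weights_nz//|]; apply: contraNT => naL.
rewrite -subv0; apply/subvP => x xa; rewrite memv0 -oppr_eq0.
(* If [a] were missing from the list, [x] minus its own decomposition would be a relation between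
   independent weight spaces. *)
pose f c := if c == a then - x else wproj c x.
have fL c : c \in L -> f c = wproj c x.
  by rewrite /f; case: eqP => // -> aL; rewrite aL in naL.
suff : f a = 0 by rewrite /f eqxx => ->.
apply: (@weight_space_indep _ _ _ h_nil (a :: L) f); rewrite ?mem_head //=.
- by rewrite naL weights_uniq.
- by move=> c _; rewrite /f; case: eqP => [->|_]; rewrite ?memvN ?wproj_mem.
by rewrite big_cons (eq_big_seq _ fL) wproj_sum /f eqxx addNr.
Qed.

Lemma wprojE a b x : x \in W a -> b \in L -> wproj b x = if b == a then x else 0.
Proof.
move=> xa bL; have [aL|] := boolP (a \in L); last first.
  rewrite mem_weights negbK => /eqP Wa0; move: xa; rewrite Wa0 memv0 => /eqP->.
  by rewrite linear0; case: ifP.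
apply/eqP; rewrite -subr_eq0; apply/eqP.
pose f c := wproj c x - (if c == a then x else 0).
apply: (@weight_space_indep _ _ _ h_nil L f) => //; first exact: weights_uniq.
  by move=> c _; rewrite memvB ?wproj_mem //; case: eqP => [->|]; rewrite ?mem0v.
rewrite sumrB wproj_sum (bigD1_seq a) ?weights_uniq //= eqxx big1 ?addr0 ?subrr //.
by move=> c /negPf->.
Qed.

Lemma wproj_projects a : a \in L -> projects_on (wproj a) (W a).
Proof.
by move=> aL; split=> x; [exact: wproj_mem | move=> xa; rewrite (wprojE xa) ?eqxx].
Qed.

(** The multiplicity of the weight [a], written as the trace of a projection. *)
Definition wmult a : F := ltrace (wproj a).

Lemma wmult_gt0 a : a \in L -> 0 < wmult a.
Proof.
move=> aL; have [n n_gt0 En] := ltrace_projection (wproj_projects aL) (weights_nz aL).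
by rewrite /wmult En ltr0n.
Qed.

Lemma ltrace_weights f : ltrace f = \sum_(a <- L) ltrace (f \o wproj a)%VF.
Proof.
rewrite -ltrace_sum; congr ltrace; apply/lfunP => x.
rewrite sum_lfunE -{1}(wproj_sum x) linear_sum.
by apply: eq_bigr => a _; rewrite comp_lfunE.
Qed.

Lemma weight0 : 0 \in L.
Proof. by rewrite mem_weights weight_space0. Qed.

Lemma killing_cartan t : t \in h ->
  killing t t = \sum_(a <- L) ev a t * ev a t * wmult a.
Proof.
move=> ht; rewrite /killing ltrace_weights; apply: eq_big_seq => a aL.
have stW := lie_stable_img (@weight_space_stable _ _ _ h_nil a) ht.
apply: (ltrace_gen_eigen (wproj_projects aL)).
  by rewrite limg_comp (subv_trans (limgS _ stW)).
by move=> x /weight_spaceP xa; apply/gen_eigen_sqr/xa.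
Qed.

(** The composite ad x ad z moves each weight by the nonzero [a + b], so it contributes no nonzero
    eigenvalue. *)
Lemma killing_orthogonal a b x z : x \in W a -> z \in W b -> a + b != 0 ->
  killing x z = 0.
Proof.
move=> xa zb nz_ab; rewrite /killing ltrace_weights big_seq big1 // => c cL.
apply: ltrace_eq0 => r v nz_v; rewrite !comp_lfunE /= !adE => Ev.
have [//|nz_r] := eqVneq r 0.
have vW : v \in W (a + (b + c)).
  rewrite -[v]scale1r -(mulVf nz_r) -scalerA -Ev memvZ //.
  by rewrite !weight_space_lieb ?wproj_mem.
move: Ev; rewrite (wprojE vW cL) ifN; last first.
  by rewrite addrA -subr_eq0 opprD addrCA subrr addr0 oppr_eq0.
by rewrite !linear0 => /esym/eqP; rewrite scaler_eq0 (negPf nz_r) (negPf nz_v).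
Qed.

(** The sum [V] of the weight spaces on the string b + Z a is stable under ad e and ad f, so ad t
    has trace 0 on it. Expanding over the string solves for b(t) with the real ratio -K/D. *)
Lemma string_trace a b e f (t := lieb e f) : e \in W a -> f \in W (- a) -> b \in L ->
  exists2 r : F, r \is Num.real & ev b t = r * ev a t.
Proof.
move=> ea fa bL.
have ht : t \in h.
  by rewrite -(weight_space0 h_sub h_nil h_norm) -(subrr a) weight_space_lieb.
pose S c := `[< exists k : int, c = b + a *~ k >].
pose V := (\sum_(c <- L | S c) W c)%VS.
pose p : 'End(g) := \sum_(c <- L | S c) wproj c.
have pV : projects_on p V.
  split=> [x|x Vx].
    rewrite sum_lfunE big_seq_cond; apply: memv_suml => c /andP[cL Sc].
    by rewrite (subvP (sumv_seq_sup _ cL Sc)) // wproj_mem.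
  have : (V <= lker (p - \1%VF))%VS.
    apply: sumv_seq_le => c cL Sc; apply/subvP => z zc.
    rewrite memv_ker add_lfunE opp_lfunE id_lfunE subr_eq0 sum_lfunE.
    rewrite -big_filter (bigD1_seq c) ?filter_uniq ?weights_uniq ?mem_filter ?Sc //=.
    rewrite (wprojE zc cL) eqxx big_filter_cond big_seq_cond big1 ?addr0 //.
    by move=> d /and3P[dL _ /negPf ndc]; rewrite (wprojE zc dL) ndc.
  by move=> /subvP/(_ x Vx); rewrite memv_ker add_lfunE opp_lfunE id_lfunE subr_eq0 => /eqP.
have stab d (z : g) : z \in W d -> (forall c, S c -> S (d + c)) -> (ad z @: V <= V)%VS.
  move=> zd Sd; apply/subvP => _ /memv_imgP[x Vx ->].
  suff : (V <= ad z @^-1: V)%VS by move/subvP/(_ x Vx); rewrite -memv_preim.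
  apply: sumv_seq_le => c cL Sc; apply/subvP => w wc; rewrite -memv_preim adE.
  have zw := weight_space_lieb zd wc.
  have [dcL|] := boolP (d + c \in L).
    by rewrite (subvP (sumv_seq_sup _ dcL (Sd c Sc))).
  by rewrite mem_weights negbK => /eqP W0; move: zw; rewrite W0 memv0 => /eqP->; rewrite mem0v.
have eV : (ad e @: V <= V)%VS.
  apply: (stab a) => // c /asboolP[k ->]; apply/asboolP; exists (1 + k).
  by rewrite mulrzDr mulr1z addrCA.
have fV : (ad f @: V <= V)%VS.
  apply: (stab (- a)) => // c /asboolP[k ->]; apply/asboolP; exists (- 1 + k).
  by rewrite mulrzDr mulrN1z addrCA.
have tr0 : \sum_(c <- L | S c) ev c t * wmult c = 0.
  rewrite -[RHS](ltrace_ad_lieb pV eV fV).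
  have -> : (ad (lieb e f) \o p = \sum_(c <- L | S c) (ad (lieb e f) \o wproj c))%VF.
    apply/lfunP => x; rewrite comp_lfunE !sum_lfunE linear_sum.
    by apply: eq_bigr => c _; rewrite comp_lfunE.
  rewrite ltrace_sum big_seq_cond [RHS]big_seq_cond; apply: eq_bigr => c /andP[cL _].
  have stW := lie_stable_img (@weight_space_stable _ _ _ h_nil c) ht.
  apply/esym/(ltrace_gen_eigen (wproj_projects cL) stW) => x /weight_spaceP xc.
  exact: xc.
(* Off the string the position is set to 0. *)
have /choice[k kP] : forall c, exists k : int, S c -> c = b + a *~ k.
  move=> c; have [[k ->]|nS] := pselect (exists k : int, c = b + a *~ k); first by exists k.
  by exists 0 => /asboolP.
pose D := \sum_(c <- L | S c) wmult c.
pose K := \sum_(c <- L | S c) (k c)%:~R * wmult c.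
have D_gt0 : 0 < D.
  have Sb : S b by apply/asboolP; exists 0; rewrite mulr0z addr0.
  rewrite /D -big_filter (bigD1_seq b) ?filter_uniq ?weights_uniq ?mem_filter ?Sb //=.
  rewrite ltr_pwDl ?wmult_gt0 // big_filter_cond big_seq_cond.
  by apply: sumr_ge0 => c /andP[cL _]; rewrite ltW ?wmult_gt0.
exists (- (K / D)).
  have Dreal : D \is Num.real by exact: gtr0_real.
  suff Kreal : K \is Num.real by rewrite rpredN rpredM ?rpredV.
  rewrite /K big_seq_cond; apply: rpred_sum => c /andP[cL _].
  by rewrite rpredM ?realz // gtr0_real ?wmult_gt0.
have evMz c (m : int) y : ev (c *~ m) y = m%:~R * ev c y.
  case: m => m; rewrite ?NegzE -?pmulrn ?mulrNz ?evN ?evMn ?mulr_natl //.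
  by rewrite mulNr -!pmulrn ?evMn ?mulr_natl.
have : ev b t * D + K * ev a t = 0.
  rewrite -[RHS]tr0 /D /K mulr_sumr mulr_suml -big_split /=.
  apply: eq_bigr => c Sc; have -> : ev c t = ev b t + (k c)%:~R * ev a t.
    by rewrite {1}(kP c Sc) evD evMz.
  by rewrite mulrDl mulrAC.
move/eqP; rewrite addr_eq0 => /eqP E.
apply: (mulIf (lt0r_neq0 D_gt0)); rewrite E mulrAC mulNr divfK ?mulNr //.
exact: lt0r_neq0.
Qed.

(* By string_trace the values ev b t are real multiples of ev a t, so that
   killing t t is a sum of squares up to a scalar. *)
Lemma killing_isotropic a b e f (t := lieb e f) :
    e \in W a -> f \in W (- a) -> killing t t = 0 -> b \in L -> ev b t = 0.
Proof.
move=> ea fa tt0 bL.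
have ht : t \in h.
  by rewrite -(weight_space0 h_sub h_nil h_norm) -(subrr a) weight_space_lieb.
have [aL|] := boolP (a \in L); last first.
  rewrite mem_weights negbK => /eqP Wa0; move: ea; rewrite Wa0 memv0 => /eqP e0.
  by rewrite /t e0 lieb0l linear0.
have /choice[r rP] : forall c, exists r : F, c \in L -> r \is Num.real /\ ev c t = r * ev a t.
  move=> c; have [cL|_] := boolP (c \in L); last by exists 0.
  by have [r rR Er] := string_trace ea fa cL; exists r.
have [at0|nz_at] := eqVneq (ev a t) 0; first by have [_ ->] := rP b bL; rewrite at0 mulr0.
have sum0 : \sum_(c <- L) r c * r c * wmult c = 0.
  have nz2 : ev a t * ev a t != 0 by rewrite mulf_neq0.
  apply: (mulfI nz2); rewrite mulr0 mulr_sumr -[RHS]tt0 (killing_cartan ht).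
  apply: eq_big_seq => c cL; have [_ ->] := rP c cL.
  by rewrite [r c * ev a t * _]mulrACA [r c * r c * (ev a t * _)]mulrC mulrA.
have terms_ge0 c : c \in L -> 0 <= r c * r c * wmult c.
  move=> cL; have [rR _] := rP c cL.
  by rewrite mulr_ge0 ?(ltW (wmult_gt0 cL)) // -expr2 real_exprn_even_ge0.
have ra0 : r a * r a * wmult a = 0.
  apply/eqP; rewrite eq_le terms_ge0 // andbT -sum0.
  rewrite (bigD1_seq a) ?weights_uniq //= lerDl big_seq_cond.
  by apply: sumr_ge0 => c /andP[cL _]; apply: terms_ge0.
(* As [a] is itself a weight, a(t) is [r a] times a(t), while the vanishing sum of squares forces
   [r a] to be 0. *)
have [_ Ea] := rP a aL; case/eqP: nz_at; rewrite Ea.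
move/eqP: ra0; rewrite !mulf_eq0 orbb (gt_eqF (wmult_gt0 aL)) orbF => /eqP->.
by rewrite mul0r.
Qed.

Hypothesis g_simple : lie_simple g.

Lemma simple_perfect : liebv {:g} {:g} = {:g}%VS.
Proof.
have [nz idealP] := g_simple; case: (idealP (liebv fullv fullv)) => //.
by apply/liebvP => u v _ _; apply: (liebvP _ _ _ (subvv _)); rewrite memvf.
Qed.

Lemma killing_nondegenerate : killing_radical g = 0%VS.
Proof.
have [_ idealP] := g_simple; have [//|Kfull] := idealP _ (killing_radical_ideal g).
have K0 x z : killing x z = 0.
  by apply: (proj1 (killing_radicalP x)); rewrite Kfull memvf.
(* [U] contains every bracket: the component in [h] comes only from pairs of opposite weights, where
   [killing_isotropic] applies. *)
pose U := vspace_of (fun x => forall b, b \in L -> ev b (wproj 0 x) = 0).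
have UP x : x \in U <-> forall b, b \in L -> ev b (wproj 0 x) = 0.
  apply: vspace_ofP; split=> [b bL|c u v u0 v0 b bL]; first by rewrite !linear0.
  by rewrite !linearP /= u0 // v0 // scaler0 addr0.
have Ufull : (fullv <= U)%VS.
  rewrite -simple_perfect; apply/liebvP => u v _ _.
  rewrite -(wproj_sum u) lieb_suml; apply: memv_suml => a _.
  rewrite -(wproj_sum v) linear_sum; apply: memv_suml => c _; apply/UP => b bL.
  have ua := wproj_mem a u; have vc := wproj_mem c v.
  rewrite (wprojE (weight_space_lieb ua vc) weight0); case: eqP => [ac0|_]; last first.
    exact: linear0.
  apply: (killing_isotropic ua) => //.
  by rewrite (_ : - a = c) //; apply/eqP; rewrite eq_sym -addr_eq0 addrC -ac0.
have hL b : b \in L -> b = 0.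
  move=> bL; apply: ev_inj => y hy; rewrite ev0.
  have /UP/(_ b bL) : y \in U by rewrite (subvP Ufull) ?memvf.
  rewrite (wprojE (a := 0)) ?weight0 ?eqxx //.
  by rewrite weight_space0.
have hfull : h = fullv.
  apply/eqP; rewrite eqEsubv subvf /= weights_full; apply: sumv_seq_le => b /hL-> _.
  by rewrite weight_space0.
(* Since [h] is now the whole perfect algebra, its lower central series never shrinks. *)
have [n] := h_nil; suff -> : iter n (liebv h) h = fullv.
  by rewrite -hfull => /eqP; rewrite (negPf h_nz).
by elim: n => //= n ->; rewrite hfull simple_perfect.
Qed.

(** Otherwise [W a] would be orthogonal to every weight space, hence inside the radical. *)
Lemma weightsN a : a \in L -> - a \in L.
Proof.
move=> aL; apply/negPn/negP => naL; have := weights_nz aL.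
rewrite -subv0 => /negP; apply; apply/subvP => x xa.
rewrite -killing_nondegenerate; apply/killing_radicalP => z.
rewrite -(wproj_sum z) linear_sum big_seq big1 // => b bL.
apply: (killing_orthogonal xa (wproj_mem b z)).
apply: contraNneq naL => ab0; rewrite (_ : - a = b) //.
by apply/eqP; rewrite -subr_eq0 -opprD ab0 oppr0.
Qed.

Lemma weights_separate y : y \in h -> (forall b, b \in L -> ev b y = 0) -> y = 0.
Proof.
move=> hy y0; apply/eqP; rewrite -memv0 -killing_nondegenerate.
apply/killing_radicalP => z; rewrite -(wproj_sum z) linear_sum big_seq big1 // => b bL.
have y0W : y \in W 0 by rewrite weight_space0.
have [Eb|nzb] := eqVneq b 0; last first.
  by apply: (killing_orthogonal y0W (wproj_mem b z)); rewrite add0r.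
have hz : wproj b z \in h by rewrite -(weight_space0 h_sub h_nil h_norm) -Eb wproj_mem.
move: (wproj b z) hz => w hw.
(* Polarization: by [killing_cartan] the form on [h] sees [y] only through the weights. *)
have sq0 : killing (y + w) (y + w) = killing w w.
  rewrite !killing_cartan ?memvD //; apply: eq_big_seq => c cL.
  by rewrite linearD /= y0 // add0r.
have : killing y w *+ 2 = 0.
  move: sq0; rewrite linearD /= (killingC _ y) (killingC _ w) !linearD /=.
  rewrite (killing_cartan hy) big_seq big1 ?add0r => [|c cL]; last by rewrite y0 // !mul0r.
  by rewrite (killingC w y) addrA -mulr2n => /eqP; rewrite -subr_eq0 addrK => /eqP.
by move/eqP; rewrite mulrn_eq0 => /eqP.
Qed.

Lemma is_root_weights a : is_root a = (a != 0) && (a \in L).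
Proof.
rewrite /is_root mem_weights; case: (a != 0) => //=; apply/idP/idP.
  apply: contraNneq => Wa0; rewrite -subv0 -Wa0; exact: root_space_weight_space.
exact: weight_space_root.
Qed.

Lemma rootsN a : a \in Defs.roots h -> - a \in Defs.roots h.
Proof.
by rewrite !in_roots !is_root_weights oppr_eq0 => /andP[-> /weightsN].
Qed.

End Cartan.

(** * Simple roots and the longest root *)

Section SimpleRoots.
Variables (F : numClosedFieldType) (g : lieAlgType F) (h : {vspace g}).
Implicit Types (a b c : dual h) (x y z u v : g) (V : {vspace g}).
Variable Pi : {fset dual h}.
Hypothesis Pi_simple : simple_roots Pi.

Let Pi_free : free Pi. Proof. by case: Pi_simple. Qed.

Lemma nonneg_comb0 : nonneg_comb Pi 0.
Proof. by exists (fun=> 0%N); rewrite big1 // => b _; rewrite mulr0n. Qed.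

Lemma nonneg_combD a b : nonneg_comb Pi a -> nonneg_comb Pi b -> nonneg_comb Pi (a + b).
Proof.
move=> [m ->] [n ->]; exists (fun c => m c + n c)%N; rewrite -big_split /=.
by apply: eq_bigr => c _; rewrite mulrnDr.
Qed.

Lemma nonneg_comb_simple b : b \in Pi -> nonneg_comb Pi b.
Proof.
move=> Pb; exists (fun c => nat_of_bool (c == b)).
rewrite (bigD1_seq b) ?fset_uniq //= eqxx big1 ?addr0 // => c /negPf->.
by rewrite mulr0n.
Qed.

(** The value 0 is a default for [b] outside [Pi]; [insub] turns the position of [b] into the
    ordinal that [coord] expects. *)
Definition simple_coef b a : F :=
  if insub (index b Pi) is Some i then coord (in_tuple Pi) i a else 0.

Lemma simple_coef_linear b : linear (simple_coef b : dual h -> F^o).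
Proof.
move=> k a c; rewrite /simple_coef; case: insub => [i|]; first exact: linearP.
by rewrite scaler0 addr0.
Qed.

HB.instance Definition _ b := GRing.isLinear.Build F (dual h) F^o *:%R (simple_coef b)
  (simple_coef_linear b).

Lemma simple_coefE b c : b \in Pi -> c \in Pi -> simple_coef b c = (b == c)%:R.
Proof.
move=> Pb Pc; rewrite /simple_coef.
case: insubP => [i _ Ei|]; last by rewrite index_mem Pb.
have lt_c : (index c Pi < size Pi)%N by rewrite index_mem.
have {1}-> : c = (in_tuple Pi)`_(Ordinal lt_c) by rewrite /= nth_index.
rewrite coord_free //; congr (nat_of_bool _)%:R; apply/eqP/eqP => E.
  by rewrite -(nth_index 0 Pb) -(nth_index 0 Pc) -Ei -E.
by apply: val_inj; rewrite /= Ei E.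
Qed.

Lemma simple_coef_comb b (n : dual h -> nat) : b \in Pi ->
  simple_coef b (\sum_(c <- Pi) c *+ n c) = (n b)%:R.
Proof.
move=> Pb; rewrite linear_sum /= (bigD1_seq b) ?fset_uniq //= big_seq_cond big1 ?addr0.
  by rewrite linearMn /= simple_coefE // eqxx.
by move=> c /andP[Pc nbc]; rewrite linearMn /= simple_coefE // eq_sym (negPf nbc) mul0rn.
Qed.

Definition height a : F := \sum_(b <- Pi) simple_coef b a.

Lemma heightD a b : height (a + b) = height a + height b.
Proof. by rewrite /height -big_split; apply: eq_bigr => c _; rewrite linearD. Qed.

Lemma heightN a : height (- a) = - height a.
Proof. by rewrite /height -sumrN; apply: eq_bigr => c _; rewrite linearN. Qed.

Lemma height_simple b : b \in Pi -> height b = 1.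
Proof.
move=> Pb; rewrite /height (bigD1_seq b) ?fset_uniq //= simple_coefE // eqxx.
rewrite big_seq_cond big1 ?addr0 // => c /andP[Pc /negPf nbc].
by rewrite simple_coefE // nbc.
Qed.

Lemma height_nonneg a : nonneg_comb Pi a -> a != 0 ->
  exists2 n : nat, (0 < n)%N & height a = n%:R.
Proof.
move=> [n Ea] nz_a; exists (\sum_(b <- Pi) n b)%N; last first.
  by rewrite /height natr_sum Ea; apply: eq_big_seq => b Pb; rewrite simple_coef_comb.
rewrite lt0n; apply: contraNneq nz_a => /eqP; rewrite sum_nat_seq_eq0 => /allP n0.
by rewrite Ea big_seq big1 // => b /n0 /eqP->; rewrite mulr0n.
Qed.

(** Two positive heights cannot cancel. *)
Lemma nonneg_comb_anti a b : nonneg_comb Pi a -> nonneg_comb Pi b -> a + b = 0 -> a = 0.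
Proof.
move=> na nb ab0; apply/eqP/negPn/negP => nz_a.
have nz_b : b != 0 by apply: contraNneq nz_a => b0; rewrite -ab0 b0 addr0.
have [m m_gt0 Em] := height_nonneg na nz_a; have [n n_gt0 En] := height_nonneg nb nz_b.
have : height (a + b) = 0 by rewrite ab0 /height big1 // => c _; rewrite linear0.
by rewrite heightD Em En -natrD => /eqP; rewrite pnatr_eq0; lia.
Qed.

(** For distinct [a] and [b] the coefficient at [b] would be -1. *)
Lemma nonneg_comb_sub_simple a b : a \in Pi -> b \in Pi -> nonneg_comb Pi (a - b) -> a = b.
Proof.
move=> Pa Pb [n E]; apply/eqP/negPn/negP => nab; have := simple_coef_comb n Pb.
rewrite -E linearB /= !simple_coefE // eqxx eq_sym (negPf nab) sub0r => /eqP.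
by rewrite eq_sym -subr_eq0 opprK -(natrD _ _ 1) pnatr_eq0 addn1.
Qed.

Lemma simple_root_nz b : b \in Pi -> b != 0.
Proof. by case: Pi_simple => sub _ _ /sub; rewrite in_roots => /andP[]. Qed.

Lemma sub_simple_roots a b : a \in Pi -> b \in Pi -> a - b \notin Defs.roots h.
Proof.
move=> Pa Pb; apply/negP => ab.
suff Eab : a = b by move: ab; rewrite Eab subrr in_roots /is_root eqxx.
case: (Pi_simple) => _ _ /(_ _ ab) []; first exact: nonneg_comb_sub_simple.
by rewrite opprB => /nonneg_comb_sub_simple->.
Qed.

End SimpleRoots.

(** * The longest root and the arithmetic of [Zdag] *)

Section LongestRoot.
Variables (F : numClosedFieldType) (g : lieAlgType F) (h : {vspace g}).
Variables (Pi : {fset dual h}) (eta : dual h).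
Hypotheses (g_simple : lie_simple g) (h_cartan : cartan_subalgebra h).
Hypothesis rank_ge2 : (2 <= \dim h)%N.
Hypotheses (Pi_simple : simple_roots Pi) (eta_longest : longest_root Pi eta).
Implicit Types (a b c : dual h) (x y z u v : g) (U V : {vspace g}).

Let h_sub : lie_subalgebra h. Proof. by case: h_cartan. Qed.
Let h_nil : lie_nilpotent h. Proof. by case: h_cartan. Qed.
Let h_norm : lie_self_normalizing h. Proof. by case: h_cartan. Qed.
Let h_nz : h != 0%VS. Proof. by rewrite -dimv_eq0 -lt0n (ltnW rank_ge2). Qed.
Local Notation W := (@weight_space F g h).
Local Notation L := (weights h_cartan).

Let eta_root : eta \in Defs.roots h. Proof. by case: eta_longest => -[]. Qed.
Let eta_nonneg : nonneg_comb Pi eta. Proof. by case: eta_longest => -[]. Qed.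

Lemma longest_nz : eta != 0.
Proof. by move: eta_root; rewrite in_roots => /andP[]. Qed.

Lemma roots_weights a : (a \in Defs.roots h) = (a != 0) && (a \in L).
Proof. by rewrite in_roots is_root_weights. Qed.

Lemma weight_nonneg_dichotomy a : a \in L -> ~ nonneg_comb Pi a ->
  a \in Defs.roots h /\ nonneg_comb Pi (- a).
Proof.
move=> aL nna; have ar : a \in Defs.roots h.
  by rewrite roots_weights aL andbT; apply: contra_notN nna => /eqP->; apply: nonneg_comb0.
by split=> //; case: Pi_simple => _ _ /(_ _ ar) [].
Qed.

(* A maximal U below M containing a root vector of eta and stable under the
   nonnegative part contains [N, U], which has the same properties; so U is an
   ideal. *)
Lemma roots_le_longest a : a \in Defs.roots h -> nonneg_comb Pi (eta - a).
Proof.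
pose M := (\sum_(c <- L | `[< nonneg_comb Pi (eta - c) >]) W c)%VS.
pose N := (\sum_(c <- L | `[< nonneg_comb Pi (- c) >]) W c)%VS.
have etaL : eta \in L by move: eta_root; rewrite roots_weights => /andP[].
have [v ve nz_v] : exists2 v, v \in root_space eta & v != 0.
  move: eta_root; rewrite in_roots => /andP[_ nz]; exists (vpick (root_space eta)).
    exact: memv_pick.
  by rewrite vpick0.
have veW : v \in W eta by rewrite (subvP (root_space_weight_space _)).
have vM : v \in M.
  rewrite (subvP (sumv_seq_sup _ etaL _)) //; apply/asboolP.
  by rewrite subrr; apply: nonneg_comb0.
pose good U := [/\ v \in U, (U <= M)%VS &
  forall b u x, nonneg_comb Pi b -> u \in W b -> x \in U -> lieb u x \in U].
pose Q k := `[< exists2 U, \dim U = k & good U >].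
(* The line of [v] is a first candidate: [h] scales the genuine root vector [v], and for a positive
   root [b] the sum b + eta is neither a root nor 0. *)
have exQ : exists k, Q k.
  exists (\dim <[v]>%VS); apply/asboolP; exists <[v]>%VS => //; split.
  - exact: memv_line.
  - by rewrite -memvE.
  move=> b u x nb ub /vlineP[k ->]; rewrite liebZr memvZ //.
  have [b0|nz_b] := eqVneq b 0.
    have hu : u \in h by rewrite -(weight_space0 h_sub h_nil h_norm) -b0.
    have /root_spaceP/(_ (Subvs hu)) /= -> := ve.
    by rewrite memvZ // memv_line.
  have [be|] := boolP (b + eta \in L); last first.
    rewrite mem_weights negbK => /eqP W0; have := weight_space_lieb ub veW.
    by rewrite W0 memv0 => /eqP->; rewrite mem0v.
  have [bL|] := boolP (b \in L); last first.
    rewrite mem_weights negbK => /eqP W0; move: ub; rewrite W0 memv0 => /eqP->.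
    by rewrite lieb0l mem0v.
  have [_ /(_ b)] := eta_longest; rewrite roots_weights be andbT negbK => E.
  have /E/eqP : positive_root Pi b by split=> //; rewrite roots_weights nz_b.
  by move/(nonneg_comb_anti Pi_simple nb eta_nonneg)/eqP; rewrite (negPf nz_b).
have leQ k : Q k -> (k <= \dim {:g})%N by case/asboolP => U <- _; apply/dimvS/subvf.
case: (ex_maxnP exQ leQ) => k /asboolP[U dU [vU UM posU]] max.
pose U' := (U + liebv N U)%VS.
have UU' : (U <= U')%VS by exact: addvSl.
have NU w x : w \in N -> x \in U -> lieb w x \in U'.
  by move=> wN xU; apply: (subvP (addvSr _ _)); apply: (liebvP _ _ _ (subvv _)).
(* Weight components of [z] with nonnegative weight preserve [U]; all others lie in [N]. *)
have gU z x : x \in U -> lieb z x \in U'.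
  move=> xU; rewrite -(wproj_sum h_cartan z) lieb_suml big_seq; apply: memv_suml => c cL.
  have zc := wproj_mem h_cartan c z.
  have [nc|nc] := pselect (nonneg_comb Pi c).
    by apply: (subvP UU'); apply: posU zc xU.
  apply: NU => //; rewrite (subvP (sumv_seq_sup _ cL _)) //.
  by apply/asboolP; have [] := weight_nonneg_dichotomy cL nc.
have NM : (liebv N U <= M)%VS.
  apply/liebvP => w x wN /(subvP UM) xM; rewrite lieb_anti memvN -adE memv_preim.
  move: wN; apply/subvP; apply: sumv_seq_le => c cL /asboolP nc; apply/subvP => {}w wc.
  rewrite -memv_preim adE lieb_anti memvN -adE memv_preim.
  move: xM; apply/subvP; apply: sumv_seq_le => d dL /asboolP nd; apply/subvP => {}x xd.
  rewrite -memv_preim adE; have wx := weight_space_lieb wc xd.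
  have [cdL|] := boolP (c + d \in L); last first.
    by rewrite mem_weights negbK => /eqP W0; move: wx; rewrite W0 memv0 => /eqP->; rewrite mem0v.
  rewrite (subvP (sumv_seq_sup _ cdL _)) //; apply/asboolP.
  by rewrite opprD addrCA; apply: nonneg_combD.
have UE : U = U'.
  apply/eqP; rewrite eqEdim UU' dU max //; apply/asboolP; exists U' => //; split.
  - exact: (subvP UU').
  - by rewrite subv_add UM.
  move=> b u x nb ub /memv_addP[x1 x1U [x2 x2NU ->]]; rewrite liebDr memvD ?(gU _ _ x1U) //.
  rewrite -adE memv_preim; move: x2NU; apply/subvP; apply/liebvP => w z wN zU.
  by rewrite -memv_preim adE lieb_der memvD ?(gU (lieb u w)) ?NU ?(posU b).
have Ufull : U = fullv.
  have [_ /(_ U)[]//] := g_simple; first by apply/liebvP => z x _ xU; rewrite UE gU.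
  by move=> U0; move: vU; rewrite U0 memv0 (negPf nz_v).
rewrite roots_weights => /andP[_ aL]; apply: contrapT => na.
have /subvP Mker : (M <= lker (wproj h_cartan a))%VS.
  apply: sumv_seq_le => c cL /asboolP nc; apply/subvP => x xc.
  rewrite memv_ker (wprojE xc aL) ifN //.
  by apply/eqP => ac; apply: na; rewrite ac.
have := weights_nz aL; rewrite -subv0 => /negP; apply; apply/subvP => x xa.
have : x \in M by rewrite (subvP UM) // Ufull memvf.
by move/Mker; rewrite memv_ker (wprojE xa aL) eqxx memv0.
Qed.

(** In rank one the longest root is the simple root, so [rank_ge2] is essential: it gives [eta] a
    nonzero kernel in [h]. *)
Lemma longest_not_simple : eta \notin Pi.
Proof.
apply/negP => Pe; have [PiR _ dich] := Pi_simple.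
have PiE b : b \in Pi -> b = eta.
  move=> Pb; apply/esym/(nonneg_comb_sub_simple Pi_simple Pe Pb)/roots_le_longest.
  exact: PiR.
have nz_ker : lker eta != 0%VS.
  apply/negP => /eqP ker0; have := limg_ker_dim eta fullv.
  rewrite ker0 capv0 dimv0 add0n => dimE; move: rank_ge2.
  have -> : \dim h = \dim {:subvs_of h} by rewrite dimvf.
  by rewrite -dimE leqNgt ltnS (leq_trans (dimvS (subvf _))) // dimvf.
pose y := vpick (lker eta).
have ey : eta y = 0 by apply/eqP; rewrite -memv_ker memv_pick.
have nz_y : y != 0 by rewrite vpick0.
have comb0 a : nonneg_comb Pi a -> ev a (vsval y) = 0.
  case=> n ->; rewrite ev_val sum_lfunE big_seq big1 // => b /PiE->.
  by rewrite -ev_val evMn ev_val ey mul0rn.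
suff : vsval y = 0 by move=> y0; case/eqP: nz_y; apply: val_inj.
apply: (weights_separate (h_cartan := h_cartan) h_nz g_simple (subvsP y)).
move=> b bL; have [/comb0//|nb] := pselect (nonneg_comb Pi b).
have [_ /comb0] := weight_nonneg_dichotomy bL nb.
by rewrite evN => /eqP; rewrite oppr_eq0 => /eqP.
Qed.

Lemma add_longest_simple b : b \in Pi -> b + eta \notin Defs.roots h.
Proof.
have [PiR _ _] := Pi_simple; have [_ H] := eta_longest.
by move=> Pb; apply: H; split; [exact: PiR | exact: nonneg_comb_simple].
Qed.

Lemma ZdagP a : a \in Zdag Pi eta -> a \in Pi \/ a = - eta.
Proof. by rewrite !inE => /orP[|/eqP]; [left|right]. Qed.

(** Up to sign, the mixed case is a simple root plus [eta], excluded by maximality of [eta]. *)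
Lemma Zdag_sub_not_root a b : a \in Zdag Pi eta -> b \in Zdag Pi eta ->
  a - b \notin Defs.roots h.
Proof.
have n0 : 0 \notin Defs.roots h by rewrite in_roots /is_root eqxx.
move=> /ZdagP[Pa|->] /ZdagP[Pb|->]; rewrite ?opprK ?addNr //.
- exact: (sub_simple_roots Pi_simple).
- exact: add_longest_simple.
apply: contra (add_longest_simple Pb) => /(rootsN h_cartan h_nz g_simple).
by rewrite opprB opprK.
Qed.

Lemma Zdag_height : exists2 n : nat, (0 < n)%N &
  forall a, a \in Zdag Pi eta -> height Pi a = 1%:~R \/ height Pi a = (- n%:Z)%:~R.
Proof.
have [n n_gt0 En] := height_nonneg Pi_simple eta_nonneg longest_nz.
exists n => // a /ZdagP[Pa|->]; first by left; rewrite height_simple.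
by right; rewrite heightN En mulrNz.
Qed.

(** With n > 0 the height of [eta], sums have height 2, 1 - n or -2n, none of which is 1 or -n. *)
Lemma Zdag_add_notin a b : a \in Zdag Pi eta -> b \in Zdag Pi eta ->
  a + b \notin Zdag Pi eta.
Proof.
have [n n_gt0 ht] := Zdag_height.
move=> /ht Ea /ht Eb; apply/negP => /ht; rewrite heightD.
by case: Ea => ->; case: Eb => -> [] /eqP; rewrite -intrD eqr_int => /eqP; clear -n_gt0; lia.
Qed.

Lemma Zdag_add_nz a b : a \in Zdag Pi eta -> b \in Zdag Pi eta -> a + b != 0.
Proof.
have nPe := longest_not_simple; move=> /ZdagP[Pa|->] /ZdagP[Pb|->].
- apply/eqP => /(nonneg_comb_anti Pi_simple (nonneg_comb_simple Pa)
    (nonneg_comb_simple Pb))/eqP.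
  by rewrite (negPf (simple_root_nz Pi_simple Pa)).
- by rewrite subr_eq0; apply: contraNneq nPe => <-.
- by rewrite addrC subr_eq0; apply: contraNneq nPe => <-.
rewrite -opprD oppr_eq0.
by apply/eqP => /(nonneg_comb_anti Pi_simple eta_nonneg eta_nonneg)/eqP; apply/negP/longest_nz.
Qed.

End LongestRoot.

(** * Brackets of root spaces *)

Section RootSpaceBrackets.
Variables (F : fieldType) (g : lieAlgType F) (h : {vspace g}).
Implicit Types (a b c : dual h) (x y z u v : g) (X : {vspace g}).
Implicit Types S T : {fset dual h}.

Lemma root_space_lieb a b u v :
  u \in root_space a -> v \in root_space b -> lieb u v \in root_space (a + b).
Proof.
move=> /root_spaceP ua /root_spaceP vb; apply/root_spaceP => y.
by rewrite lieb_der ua vb liebZl liebZr add_lfunE scalerDl.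
Qed.

Lemma root_space_sum_sup S a : a \in S -> (root_space a <= root_space_sum S)%VS.
Proof. by move=> aS; apply: sumv_seq_sup. Qed.

Lemma liebv_root_space_sum_cartan S :
  (liebv h (root_space_sum S) <= root_space_sum S)%VS.
Proof.
apply/liebvP => y x hy; rewrite -adE memv_preim; apply/subvP.
apply: sumv_seq_le => a aS _; apply/subvP => {}x xa; rewrite -memv_preim adE.
have /root_spaceP/(_ (Subvs hy)) /= -> := xa.
by rewrite memvZ // (subvP (root_space_sum_sup aS)).
Qed.

Lemma liebv_root_space_sum S T X :
    (forall a b, a \in S -> b \in T -> (root_space (a + b)%R <= X)%VS) ->
  (liebv (root_space_sum S) (root_space_sum T) <= X)%VS.
Proof.
(* Antisymmetry moves [u] to the second argument, where membership becomes a preimage under ad and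
   can be checked on summands. *)
move=> sub; apply/liebvP => u v uS vT; rewrite lieb_anti memvN -adE memv_preim.
move: uS; apply/subvP; apply: sumv_seq_le => a aS _; apply/subvP => {}u ua.
rewrite -memv_preim adE lieb_anti memvN -adE memv_preim.
move: vT; apply/subvP; apply: sumv_seq_le => b bT _; apply/subvP => {}v vb.
by rewrite -memv_preim adE (subvP (sub a b aS bT)) // root_space_lieb.
Qed.

Lemma root_space_sub a X : a != 0 -> (a \in Defs.roots h -> (root_space a <= X)%VS) ->
  (root_space a <= X)%VS.
Proof.
move=> nz_a sub; have [->|nz] := eqVneq (root_space a) 0%VS; first exact: sub0v.
by apply: sub; rewrite in_roots /is_root nz_a.
Qed.

(** An element that commutes with [h] normalizes it. *)
Lemma root_space0_sub : lie_self_normalizing h -> (root_space (0%R : dual h) <= h)%VS.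
Proof.
move=> h_norm; apply/subvP => x /root_spaceP x0; apply: h_norm => u hu.
have /= E := x0 (Subvs hu).
by rewrite lieb_anti E zero_lfunE scale0r oppr0 mem0v.
Qed.

Lemma ZsetE Pi eta a :
  (a \in Zset Pi eta) = (a \in Defs.roots h) && (- a \in Zdag Pi eta).
Proof. by rewrite /Zset in_fset /= !inE. Qed.

Lemma root_space_g1_Z Pi eta a : a \in Defs.roots h -> a \notin Zdag Pi eta ->
  (root_space a <= g_1 Pi eta + g_Z Pi eta)%VS.
Proof.
move=> ar aNZ; have [aZ|aNZ'] := boolP (a \in Zset Pi eta).
  exact: subv_trans (root_space_sum_sup aZ) (addvSr _ _).
apply: subv_trans (addvSl _ _); apply: root_space_sum_sup.
by rewrite in_fsetD in_fsetU negb_or aNZ' aNZ.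
Qed.

Lemma root_space_g1_Zdag Pi eta a : a \in Defs.roots h -> a \notin Zset Pi eta ->
  (root_space a <= g_1 Pi eta + g_Zdag Pi eta)%VS.
Proof.
move=> ar aNZ; have [aZ|aNZ'] := boolP (a \in Zdag Pi eta).
  exact: subv_trans (root_space_sum_sup aZ) (addvSr _ _).
apply: subv_trans (addvSl _ _); apply: root_space_sum_sup.
by rewrite in_fsetD in_fsetU negb_or aNZ' aNZ.
Qed.

End RootSpaceBrackets.

(** * The eight inclusions *)

Local Open Scope complex_scope.

Theorem proposition2p2p2 (R : realType) (g : lieAlgType R[i])
    (h : {vspace g}) (Pi : {fset dual h}) (eta : dual h)
    (g_simple : lie_simple g)
    (h_cartan : cartan_subalgebra h)
    (rank_ge2 : (2 <= \dim h)%N)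
    (Pi_simple : simple_roots Pi)
    (eta_longest : longest_root Pi eta) :
  ((liebv h (g_Zdag Pi eta) <= g_Zdag Pi eta) /\
   (liebv h (g_Z Pi eta) <= g_Z Pi eta) /\
   (liebv h (g_1 Pi eta) <= g_1 Pi eta) /\
   (liebv (g_Z Pi eta) (g_Zdag Pi eta) <= h) /\
   (liebv (g_Zdag Pi eta) (g_1 Pi eta) <= g_1 Pi eta + g_Z Pi eta) /\
   (liebv (g_Z Pi eta) (g_1 Pi eta) <= g_1 Pi eta + g_Zdag Pi eta) /\
   (liebv (g_Z Pi eta) (g_Z Pi eta) <= g_1 Pi eta + g_Zdag Pi eta) /\
   (liebv (g_Zdag Pi eta) (g_Zdag Pi eta) <= g_1 Pi eta + g_Z Pi eta))%VS.
Proof.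
have sub_nr := Zdag_sub_not_root g_simple h_cartan rank_ge2 Pi_simple eta_longest.
have add_nz := Zdag_add_nz g_simple h_cartan rank_ge2 Pi_simple eta_longest.
have add_notin := Zdag_add_notin Pi_simple eta_longest.
have [_ _ h_norm] := h_cartan.
have g1P b : b \in (Defs.roots h `\` (Zset Pi eta `|` Zdag Pi eta))%fset ->
    [/\ b \in Defs.roots h, b \notin Zdag Pi eta & - b \notin Zdag Pi eta].
  rewrite in_fsetD in_fsetU negb_or ZsetE => /andP[/andP[nZ nZd] br].
  by move: nZ; rewrite br.
do 3![split; first exact: liebv_root_space_sum_cartan].
split.
  (* Here a + b is the difference of [b] and [- a], both in [Zdag], so only weight 0 survives. *)
  apply: liebv_root_space_sum => a b; rewrite ZsetE => /andP[_ Za] Zb.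
  have [->|nz] := eqVneq (a + b) 0; first exact: root_space0_sub.
  apply: root_space_sub => //; have := sub_nr _ _ Zb Za.
  by rewrite opprK addrC => /negPf->.
split.
  apply: liebv_root_space_sum => a b Za /g1P[br _ nZNb].
  apply: root_space_sub => [|ab].
    by apply: contraNneq nZNb => ab0; rewrite -(addr0 (- b)) -ab0 addrC addrK.
  (* If a + b were in [Zdag], the root [b] would be a difference of two elements of [Zdag]. *)
  apply: root_space_g1_Z => //; apply: contraL br => Zab.
  by have := sub_nr _ _ Zab Za; rewrite addrAC subrr add0r.
split.
  apply: liebv_root_space_sum => a b; rewrite ZsetE => /andP[_ Za] /g1P[br nZb _].
  apply: root_space_sub => [|ab].
    by apply: contraNneq nZb => ab0; rewrite -(addr0 b) -oppr0 -ab0 opprD addrCA subrr addr0.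
  (* Likewise [b] would be the difference of [- a] and [- (a + b)]. *)
  apply: root_space_g1_Zdag => //; rewrite ZsetE ab /=; apply: contraL br => Zab.
  by have := sub_nr _ _ Za Zab; rewrite opprK addrA addNr add0r.
split.
  apply: liebv_root_space_sum => a b; rewrite !ZsetE => /andP[_ Za] /andP[_ Zb].
  apply: root_space_sub => [|ab].
    by have := add_nz _ _ Za Zb; rewrite -opprD oppr_eq0.
  apply: root_space_g1_Zdag => //; rewrite ZsetE ab /= opprD.
  exact: add_notin.
apply: liebv_root_space_sum => a b Za Zb; apply: root_space_sub => [|ab]; first exact: add_nz.
apply: root_space_g1_Z => //; exact: add_notin.
Qed.
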